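(* Let $K$ be a field, let $S=K[u_1,\ldots,u_r]$ be a positively graded $K$-algebra with $u_i$ homogeneous of degree $a_i\ge 1$, let $D=\operatorname{lcm}(a_1,\ldots,a_r)$, and let $M=\bigoplus_{n\ge 0}M_n$ be a finitely generated graded $S$-module of Krull dimension $m\ge 0$. Let $\alpha(M)$, $d_{M,k}$, $\zeta_M(z)$ and $\theta_M(z)$ be as defined in the context. Then $$\zeta_M(z)= \theta_M(z) + \sum_{k=0}^{m-1} \frac{1}{D^{z-k}} \sum_{j=0}^{D-1} d_{M,k}(j+\alpha(M))\, \zeta\!\left(z-k, \frac{j+\alpha(M)+1}{D}\right),$$ where $\zeta(z,x)=\sum_{n=0}^\infty \frac{1}{(n+x)^z}$ is the Hurwitz zeta function. The function $\zeta_M(z)$ is meromorphic with poles at most in the set $\{1,\ldots,m\}$, which are all simple with residues $$R_M(k+1):=\operatorname{Res}_{z=k+1}\zeta_M(z) = \frac{1}{D} \sum_{j=0}^{D-1} d_{M,k}(j),\qquad 0\leq k\leq m-1.$$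
   Context: A positively graded $K$-algebra is a finitely generated graded $K$-algebra $S=\bigoplus_{n\ge0}S_n$ with $S_0=K$. The Hilbert function of $M$ is $H(M,n)=\dim_K M_n$, $n\ge 0$. By a theorem of Serre there is a quasi-polynomial $q_M(n)=d_{M,m-1}(n)n^{m-1}+\cdots+d_{M,1}(n)n+d_{M,0}(n)$ of degree $m-1$ (with $q_M=0$ if $m=0$), with $d_{M,k}(n+D)=d_{M,k}(n)$ for all $n\ge 0$ and $0\le k\le m-1$, such that $H(M,n)=q_M(n)$ for all $n\gg 0$. Put $\alpha(M)=\min\{n_0\ge 0: H(M,n)=q_M(n)\text{ for all }n\ge n_0\}$. With $\zeta_M(z,w)=\sum_{n\ge 0}\frac{H(M,n)}{(n+w)^z}$ for real $w>0$, define $$\zeta_M(z)=\lim_{w\searrow 0}\bigl(\zeta_M(z,w)-H(M,0)w^{-z}\bigr)=\sum_{n=1}^{\infty}\frac{H(M,n)}{n^z},\qquad \theta_M(z)=\sum_{n=1}^{\alpha(M)-1}\frac{H(M,n)}{n^z}.$$ Infinite series are understood by meromorphic continuation outside their region of convergence.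
   Formalization: The summand d_{M,k}(j+α(M)) ζ(z−k,(j+α(M)+1)/D) is false as printed (e.g. M=K[u](−1), deg u=1, gives ζ(z)−1 instead of ζ(z)); it is replaced by d_{M,k}(j+β) ζ(z−k,(j+β)/D) with β=max(1,α(M)). *)

(* Defs.v *)
From HB Require Import structures.
From mathcomp Require Import all_boot all_order all_algebra.
From mathcomp Require Import ring_quotient complex.
From mathcomp Require Import all_classical all_reals all_analysis.
Set Implicit Arguments.
Unset Strict Implicit.
Unset Printing Implicit Defensive.
Import Order.TTheory GRing.Theory Num.Theory.
Import numFieldNormedType.Exports.
Local Open Scope classical_set_scope.
Local Open Scope ring_scope.

Section Graded.

(* V is the internal direct sum of the G n. *)
Definition direct_sum (V : zmodType) (G : nat -> {pred V}) : Prop :=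
  (forall x : V, exists N : nat, exists2 f : nat -> V,
     (forall i, f i \in G i) & x = \sum_(i < N) f i) /\
  (forall (N : nat) (f : nat -> V), (forall i, f i \in G i) ->
     \sum_(i < N) f i = 0 -> forall i : 'I_N, f i = 0).

Definition positively_graded (K : fieldType) (S : comAlgType K)
    (SG : nat -> {pred S}) : Prop :=
  [/\ forall n, GRing.submod_closed (SG n),
      forall i j x y, x \in SG i -> y \in SG j -> x * y \in SG (i + j)%N,
      direct_sum SG
    & forall x, x \in SG 0%N <-> exists c : K, x = c%:A].

(* S = K[u_1, ..., u_r]: the only subalgebra containing all u_i is S. *)
Definition generated_by (K : fieldType) (S : comAlgType K) (r : nat)
    (u : 'I_r -> S) : Prop :=
  forall A : {pred S}, GRing.subalg_closed A ->
    (forall i, u i \in A) -> forall x, x \in A.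

Definition graded_module (K : fieldType) (S : comAlgType K)
    (SG : nat -> {pred S}) (M : lmodType S) (MG : nat -> {pred M}) : Prop :=
  [/\ forall n, GRing.zmod_closed (MG n),
      forall i j s x, s \in SG i -> x \in MG j -> s *: x \in MG (i + j)%N
    & direct_sum MG].

Definition finitely_generated (S : nzRingType) (M : lmodType S) : Prop :=
  exists n, exists e : 'I_n -> M,
    forall x, exists c : 'I_n -> S, x = \sum_i c i *: e i.

(* Krull dimension of M as that of S / Ann M: the chains below consist of the
   primes of S containing Ann M.  In particular M = 0 has no krull_dim in nat. *)
Definition prime_over_ann (S : comNzRingType) (M : lmodType S)
    (p : {pred S}) : Prop :=
  [/\ idealr_closed p, prime_idealr_closed p
    & forall s : S, (forall x : M, s *: x = 0) -> s \in p].

Definition prime_chain (S : comNzRingType) (M : lmodType S) (n : nat) : Prop :=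
  exists p : nat -> {pred S},
    (forall i, (i <= n)%N -> prime_over_ann M (p i)) /\
    (forall i, (i < n)%N -> {subset p i <= p i.+1} /\
       exists2 s, s \in p i.+1 & s \notin p i).

Definition krull_dim (S : comNzRingType) (M : lmodType S) (m : nat) : Prop :=
  prime_chain M m /\ forall n, prime_chain M n -> (n <= m)%N.

Definition has_dim (K : fieldType) (S : comAlgType K) (M : lmodType S)
    (V : {pred M}) (n : nat) : Prop :=
  exists e : 'I_n -> M, (forall i, e i \in V) /\
    forall x, x \in V ->
      exists! c : {ffun 'I_n -> K}, x = \sum_i (c i)%:A *: e i.

Definition hilbert (K : fieldType) (S : comAlgType K) (M : lmodType S)
    (MG : nat -> {pred M}) (n : nat) : nat :=
  xget 0%N [set l | has_dim (MG n) l].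

End Graded.

(* The complex field, folded so that the topology and the normed-module
   structure of a numFieldType are found on it. *)
Definition C (R : realType) : numClosedFieldType := complex R.

Section QuasiPolynomial.
Variable R : realType.

Definition quasi_poly (m : nat) (d : nat -> nat -> C R) (n : nat) : C R :=
  \sum_(k < m) d k n * n%:R ^+ k.

Definition agree_from (H : nat -> nat) (m : nat) (d : nat -> nat -> C R)
    (N : nat) : Prop :=
  forall n, (N <= n)%N -> (H n)%:R = quasi_poly m d n.

(* d is the system of coefficients (d_k)_(k < m), of period D, of the
   quasi-polynomial of degree m - 1 (zero if m = 0) which eventually equals H;
   such a system is unique.  The values d k for m <= k are irrelevant. *)
Definition hilbert_quasi_poly (H : nat -> nat) (D m : nat)
    (d : nat -> nat -> C R) : Prop :=
  [/\ forall k n, (k < m)%N -> d k (n + D)%N = d k n,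
      (0 < m)%N -> exists n, d m.-1 n != 0
    & exists N, agree_from H m d N].

Definition alpha (H : nat -> nat) (m : nat) (d : nat -> nat -> C R) : nat :=
  xget 0%N [set N | agree_from H m d N /\
                    forall N', agree_from H m d N' -> (N <= N')%N].

(* The sum of H n / n^z starts at n = 1, so after theta it resumes at
   n = max(1, alpha); this is alpha unless alpha = 0. *)
Definition tail_start (H : nat -> nat) (m : nat) (d : nat -> nat -> C R) : nat :=
  maxn 1 (alpha H m d).

End QuasiPolynomial.

Section ComplexAnalysis.
Variable R : realType.
Implicit Types (f g : C R -> C R) (p z : C R) (x : R).

Definition cexp z : C R :=
  Complex (expR (complex.Re z) * cos (complex.Im z))
          (expR (complex.Re z) * sin (complex.Im z)).

(* x ^ z for x > 0 *)
Definition cpow x z : C R := cexp (Complex (ln x) 0 * z).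

Definition holomorphic_at f p : Prop := \forall z \near p, derivable f z 1.

(* The Laurent expansion of f at p has principal part
   c_0 / (z - p) + c_1 / (z - p)^2 + ... *)
Definition principal_part f p (c : seq (C R)) : Prop :=
  exists2 g, holomorphic_at g p &
    \forall z \near p^',
      f z = \sum_(i < size c) c`_i / (z - p) ^+ i.+1 + g z.

Definition pole f p : Prop :=
  exists2 c, principal_part f p c & has (fun b => b != 0) c.

Definition simple_pole f p : Prop :=
  exists2 b, b != 0 & principal_part f p [:: b].

Definition residue f p (b : C R) : Prop :=
  exists2 c, principal_part f p c & b = c`_0.

Definition meromorphic f : Prop := forall p, holomorphic_at f p \/ pole f p.

(* zeta(z, x), x > 0: the continuation of \sum_(n >= 0) (n + x)^(-z), Re z > 1,
   to C \ {1}, with a simple pole of residue 1 at z = 1.  These conditions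
   determine it away from z = 1; its value at z = 1 carries no meaning. *)
Definition is_hurwitz_zeta x f : Prop :=
  [/\ forall z, z != 1 -> holomorphic_at f z,
      principal_part f 1 [:: 1]
    & forall z, 1 < complex.Re z ->
        series (fun n => (cpow (n%:R + x) z)^-1) @ \oo --> f z].

Definition hurwitz_zeta x : C R -> C R :=
  xget (fun=> 0) [set f | is_hurwitz_zeta x f].

(* f is the meromorphic continuation of \sum_(n >= 1) H n / n^z from the
   half-plane Re z > sigma; f is unique up to its values at its poles. *)
Definition zeta_continuation (H : nat -> nat) (sigma : R) f : Prop :=
  meromorphic f /\
  forall z, sigma < complex.Re z ->
    series (fun n => (H n.+1)%:R / cpow n.+1%:R z) @ \oo --> f z.

Definition theta (H : nat -> nat) (m : nat) (d : nat -> nat -> C R) z : C R :=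
  \sum_(1 <= n < alpha H m d) (H n)%:R / cpow n%:R z.

End ComplexAnalysis.

(* Main.v *)
(** Only the quasi-polynomial formula for the Hilbert function matters.  Writing
H n = sum_k d_k n * n^k for n >= b and sorting n by its class modulo D turns
sum_(n >= b) H n / n^z into a finite combination of the Hurwitz series
zeta(z - k, (j + b) / D), so everything rests on the continuation of zeta(z, x).

That continuation is elementary.  With G = t^(-w), the Euler-Maclaurin remainder
G'(t) - sum_(j < J) (B_j / j!) (G^(j)(t + 1) - G^(j)(t)) is bounded by a multiple of
sup |G^(J+1)| over [t, t + 1], hence it is summable over t = n + x when J is
large compared with - Re w; the corrections telescope, and the limit is
an entire function Phi with zeta(w + 1, x) = - Phi(w) / w and Phi(0) = -1.
Holomorphy needs no Cauchy theory: differentiating in w multiplies t^(-w) by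
- ln t, so the same bound for (ln t)^3 t^(-w) gives third-order Taylor expansions
of the partial sums with uniform remainder.  These pass to the limit, and order
three is enough to remove the singularity of (Phi(w) - Phi(0)) / w.

Principal parts are unique, by comparing polynomials in z - p; hence a vanishing
residue at k + 1 means no pole, and zeta_M takes its limit value there. *)
Require Import Defs.
From mathcomp Require Import all_boot all_order all_algebra.
From mathcomp Require Import complex ring lra.
From mathcomp Require Import all_classical all_reals all_analysis.
Import Order.TTheory GRing.Theory Num.Theory.
Import numFieldNormedType.Exports.
Local Open Scope classical_set_scope.
Local Open Scope ring_scope.
Set Implicit Arguments.
Unset Strict Implicit.
Unset Printing Implicit Defensive.

(** * Complex-valued functions of a real variable *)

Section ComplexNumbers.
Variable R : realType.
Implicit Types (z w : C R) (x y s t : R).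

(** Norms in [C R] are themselves complex numbers; writing every bound as [rc B] with [B : R] moves
    inequalities to the real order, by [ler_rc]. *)
Definition rc x : C R := Complex x 0.

Lemma rcD x y : rc (x + y) = rc x + rc y.
Proof. exact: (rmorphD (real_complex R)). Qed.

Lemma rcN x : rc (- x) = - rc x.
Proof. exact: (rmorphN (real_complex R)). Qed.

Lemma rcM x y : rc (x * y) = rc x * rc y.
Proof. exact: (rmorphM (real_complex R)). Qed.

Lemma rcX x n : rc (x ^+ n) = rc x ^+ n.
Proof. exact: (rmorphXn (real_complex R)). Qed.

Lemma rcV x : rc x^-1 = (rc x)^-1.
Proof. exact: (fmorphV (real_complex R)). Qed.

Lemma rcn n : rc n%:R = n%:R.
Proof. exact: (rmorph_nat (real_complex R)). Qed.

Lemma rc0 : rc 0 = 0. Proof. exact: (rcn 0). Qed.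

Lemma rc1 : rc 1 = 1. Proof. exact: (rcn 1). Qed.

Lemma rc_sum n (F : 'I_n -> R) : rc (\sum_(i < n) F i) = \sum_(i < n) rc (F i).
Proof. exact: (rmorph_sum (real_complex R)). Qed.

Lemma ler_rc x y : (rc x <= rc y) = (x <= y).
Proof. exact: lecR. Qed.

Lemma ltr_rc x y : (rc x < rc y) = (x < y).
Proof. exact: ltcR. Qed.

Lemma norm_rcE z : `|z| = rc (Num.sqrt (complex.Re z ^+ 2 + complex.Im z ^+ 2)).
Proof. by case: z. Qed.

Lemma norm_rc x : `|rc x| = rc `|x|.
Proof. by rewrite norm_rcE /= expr0n addr0 sqrtr_sqr. Qed.

Lemma Re_le_norm z : rc `|complex.Re z| <= `|z|.
Proof.
by rewrite norm_rcE ler_rc -sqrtr_sqr ler_wsqrtr// lerDl sqr_ge0.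
Qed.

Lemma Im_le_norm z : rc `|complex.Im z| <= `|z|.
Proof.
by rewrite norm_rcE ler_rc -sqrtr_sqr ler_wsqrtr// lerDr sqr_ge0.
Qed.

Lemma Re_le_rc z x : `|z| <= rc x -> `|complex.Re z| <= x.
Proof. by move=> H; rewrite -ler_rc (le_trans (Re_le_norm z)). Qed.

Lemma norm_le_rc_ge0 z x : `|z| <= rc x -> 0 <= x.
Proof. by move=> H; rewrite -ler_rc rc0 (le_trans _ H). Qed.

Lemma norm_le_ReIm z : `|z| <= rc (`|complex.Re z| + `|complex.Im z|).
Proof.
have {1}-> : z = rc (complex.Re z) + (Complex 0 1 : C R) * rc (complex.Im z).
  exact: (complexE z).
rewrite (le_trans (ler_normD _ _))// normrM !norm_rc.
have -> : `|Complex 0 1 : C R| = 1 by rewrite norm_rcE /= expr0n expr1n add0r sqrtr1 rc1.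
by rewrite mul1r -rcD.
Qed.

Lemma ReD z w : complex.Re (z + w) = complex.Re z + complex.Re w.
Proof. by case: z; case: w. Qed.

Lemma ImD z w : complex.Im (z + w) = complex.Im z + complex.Im w.
Proof. by case: z; case: w. Qed.

Lemma ReN z : complex.Re (- z) = - complex.Re z.
Proof. by case: z. Qed.

Lemma ImN z : complex.Im (- z) = - complex.Im z.
Proof. by case: z. Qed.

Lemma ReM z w : complex.Re (z * w) =
  complex.Re z * complex.Re w - complex.Im z * complex.Im w.
Proof. by case: z; case: w. Qed.

Lemma ImM z w : complex.Im (z * w) =
  complex.Re z * complex.Im w + complex.Im z * complex.Re w.
Proof. by case: z; case: w. Qed.

Lemma Re_rcM x z : complex.Re (rc x * z) = x * complex.Re z.
Proof. by rewrite ReM /= mul0r subr0. Qed.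

Lemma Re_nat n : complex.Re (n%:R : C R) = n%:R.
Proof. by rewrite -rcn. Qed.

Lemma cexpD z w : cexp (z + w) = cexp z * cexp w.
Proof.
apply/eqP; rewrite eq_complex ReM ImM /= ReD ImD expRD cosD sinD.
by apply/andP; split; apply/eqP; ring.
Qed.

Lemma cexp0 : cexp 0 = 1 :> C R.
Proof. by rewrite /cexp /= expR0 cos0 sin0 mulr1 mulr0. Qed.

Lemma norm_cexp z : `|cexp z| = rc (expR (complex.Re z)).
Proof.
rewrite norm_rcE /= !exprMn -mulrDr cos2Dsin2 mulr1 sqrtr_sqr.
by rewrite ger0_norm // expR_ge0.
Qed.

Lemma cexp_neq0 z : cexp z != 0.
Proof. by rewrite -normr_gt0 norm_cexp -rc0 ltr_rc expR_gt0. Qed.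

Lemma cexpN z : cexp (- z) = (cexp z)^-1.
Proof.
apply: (mulfI (cexp_neq0 z)); rewrite divff ?cexp_neq0 //.
by rewrite -cexpD subrr cexp0.
Qed.

Lemma cexp_rc x : cexp (rc x) = rc (expR x).
Proof. by rewrite /cexp /= cos0 sin0 mulr1 mulr0. Qed.

(** Componentwise, so that the real derivation rules and the real mean value theorem apply to
    complex values. *)
Definition cderiv (phi : R -> C R) s (l : C R) :=
  is_derive s 1 (fun t => complex.Re (phi t)) (complex.Re l) /\
  is_derive s 1 (fun t => complex.Im (phi t)) (complex.Im l).

Lemma cderiv_eq phi psi s (l k : C R) :
  (forall t, phi t = psi t) -> l = k -> cderiv phi s l -> cderiv psi s k.
Proof. by move=> /funext -> ->. Qed.

Lemma cderiv_cst (a : C R) s : cderiv (fun=> a) s 0.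
Proof. by split; exact: is_derive_cst. Qed.

Lemma cderivD (phi psi : R -> C R) s (l k : C R) :
  cderiv phi s l -> cderiv psi s k ->
  cderiv (fun t => phi t + psi t) s (l + k).
Proof.
move=> [p1 p2] [q1 q2]; split.
- rewrite ReD (_ : (fun t => _) = (fun t => complex.Re (phi t)) +
    (fun t => complex.Re (psi t))); first exact: is_deriveD.
  by apply/funext => t; rewrite ReD.
- rewrite ImD (_ : (fun t => _) = (fun t => complex.Im (phi t)) +
    (fun t => complex.Im (psi t))); first exact: is_deriveD.
  by apply/funext => t; rewrite ImD.
Qed.

Lemma cderivM (phi psi : R -> C R) s (l k : C R) :
  cderiv phi s l -> cderiv psi s k ->
  cderiv (fun t => phi t * psi t) s (l * psi s + phi s * k).
Proof.
move=> [p1 p2] [q1 q2]; split.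
- rewrite (_ : (fun t => _) = (fun t => complex.Re (phi t)) *
    (fun t => complex.Re (psi t)) - (fun t => complex.Im (phi t)) *
    (fun t => complex.Im (psi t))); last by apply/funext => t; rewrite ReM.
  by apply: is_derive_eq; rewrite ReD !ReM /GRing.scale /=; ring.
- rewrite (_ : (fun t => _) = (fun t => complex.Re (phi t)) *
    (fun t => complex.Im (psi t)) + (fun t => complex.Im (phi t)) *
    (fun t => complex.Re (psi t))); last by apply/funext => t; rewrite ImM.
  by apply: is_derive_eq; rewrite ImD !ImM /GRing.scale /=; ring.
Qed.

Lemma cderivMl (a : C R) (phi : R -> C R) s (l : C R) :
  cderiv phi s l -> cderiv (fun t => a * phi t) s (a * l).
Proof.
move=> dphi; apply: cderiv_eq (cderivM (cderiv_cst a s) dphi) => //.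
by rewrite mul0r add0r.
Qed.

Lemma cderiv_sum n (phi : 'I_n -> R -> C R) s (l : 'I_n -> C R) :
  (forall i, cderiv (phi i) s (l i)) ->
  cderiv (fun t => \sum_(i < n) phi i t) s (\sum_(i < n) l i).
Proof.
elim: n phi l => [|n IH] phi l dphi.
  apply: cderiv_eq (cderiv_cst 0 s) => [t|]; by rewrite big_ord0.
apply: cderiv_eq (cderivD (dphi ord0) (IH (fun i => phi (lift ord0 i))
  (fun i => l (lift ord0 i)) (fun i => dphi (lift ord0 i)))) => [t|];
  by rewrite big_ord_recl.
Qed.

Lemma cderiv_rc (f : R -> R) s (l : R) :
  is_derive s 1 f l -> cderiv (fun t => rc (f t)) s (rc l).
Proof. by move=> df; split => //=; exact: is_derive_cst. Qed.

Lemma cderivX (phi : R -> C R) s (l : C R) n : cderiv phi s l ->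
  cderiv (fun t => phi t ^+ n) s (n%:R * phi s ^+ n.-1 * l).
Proof.
move=> dphi; elim: n => [|n IH].
  by apply: cderiv_eq (cderiv_cst 1 s) => [t|]; rewrite ?mul0r.
apply: cderiv_eq (cderivM dphi IH) => [t|]; first by rewrite exprS.
case: n {IH} => [|n] /=; first by ring.
by rewrite [n.+2%:R]mulrSr [phi s ^+ n.+1]exprS; ring.
Qed.

Lemma cderiv_cexp (phi : R -> C R) s (l : C R) :
  cderiv phi s l -> cderiv (fun t => cexp (phi t)) s (l * cexp (phi s)).
Proof.
move=> [p1 p2].
have dE : is_derive s 1 (expR \o (fun t => complex.Re (phi t)))
  (expR (complex.Re (phi s)) * complex.Re l) by exact: is_derive1_comp.
have dC : is_derive s 1 (cos \o (fun t => complex.Im (phi t)))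
  (- sin (complex.Im (phi s)) * complex.Im l) by exact: is_derive1_comp.
have dS : is_derive s 1 (sin \o (fun t => complex.Im (phi t)))
  (cos (complex.Im (phi s)) * complex.Im l) by exact: is_derive1_comp.
split.
- rewrite (_ : (fun t => _) = (expR \o (fun t => complex.Re (phi t))) *
    (cos \o (fun t => complex.Im (phi t)))) //.
  by apply: is_derive_eq; rewrite ReM /GRing.scale /=; ring.
- rewrite (_ : (fun t => _) = (expR \o (fun t => complex.Re (phi t))) *
    (sin \o (fun t => complex.Im (phi t)))) //.
  by apply: is_derive_eq; rewrite ImM /GRing.scale /=; ring.
Qed.

(* Apply the real mean value theorem to Re (conj u * phi), where
   u = phi s - phi 0. *)
Lemma cderiv_mvt (phi dphi : R -> C R) s (B : R) : 0 <= s ->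
  (forall t, 0 <= t <= s -> cderiv phi t (dphi t)) ->
  (forall t, 0 <= t <= s -> `|dphi t| <= rc B) ->
  `|phi s - phi 0| <= rc (B * s).
Proof.
rewrite le_eqVlt => /predU1P[<- _ _|s0 dp bd].
  by rewrite subrr normr0 mulr0 -rc0.
set u := phi s - phi 0.
pose v : C R := Complex (complex.Re u) (- complex.Im u).
pose f t := complex.Re (v * phi t).
pose df t := complex.Re (v * dphi t).
have fd t : 0 <= t <= s -> is_derive t 1 f (df t).
  by move=> ts; have [] := cderivMl v (dp t ts).
have [c||c cs fE] := @MVT R f df 0 s s0.
- by rewrite in_itv /= => /andP[c0 cs]; apply: fd; rewrite !ltW.
- apply: derivable_within_continuous => c; rewrite in_itv /= => cs.
  by have [] := fd c cs.
have cs' : 0 <= c <= s by move: cs; rewrite in_itv /= => /andP[c0 c1]; rewrite !ltW.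
have nv : `|v| = `|u| by rewrite !norm_rcE /= sqrrN.
have uE : `|u| ^+ 2 = rc (f s - f 0).
  have -> : f s - f 0 = complex.Re (v * u) by rewrite /f /u !ReM !ReD !ImD !ReN !ImN; ring.
  rewrite norm_rcE -rcX sqr_sqrtr ?addr_ge0 ?sqr_ge0 //; congr rc.
  by rewrite ReM /=; ring.
have [->|u0] := eqVneq `|u| 0.
  rewrite -rc0 ler_rc mulr_ge0 ?(ltW s0) // -ler_rc rc0.
  exact: le_trans (bd c cs').
have u0' : 0 < `|u| by rewrite lt_def u0 normr_ge0.
rewrite -(ler_pM2l u0') -expr2 uE fE subr0 !rcM mulrA ler_wpM2r //.
  by rewrite -rc0 ler_rc ltW.
apply: le_trans (ler_wpM2l (ltW u0') (bd c cs')).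
rewrite -{1}nv -normrM; apply: le_trans (Re_le_norm _).
by rewrite ler_rc ler_norm.
Qed.

(** By induction: the derivative of the remainder is the remainder of the shifted family, one order
    lower, and the mean value inequality carries its bound over. The factor $s^n/n!$ is given up,
    since $s\le1$ is enough. *)
Lemma ctaylor (n : nat) (phi : nat -> R -> C R) s (B : R) : 0 <= s <= 1 ->
  (forall i t, (i < n)%N -> 0 <= t <= 1 -> cderiv (phi i) t (phi i.+1 t)) ->
  (forall t, 0 <= t <= 1 -> `|phi n t| <= rc B) ->
  `|phi 0 s - \sum_(i < n) phi i 0 * (rc s ^+ i / i`!%:R)| <= rc B.
Proof.
elim: n phi s => [|n IH] phi s s01 dphi bd.
  by rewrite big_ord0 subr0 bd.
have B0 : 0 <= B.
  by rewrite -ler_rc rc0 (le_trans _ (bd 0 _)) // lexx ler01.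
pose psi t := phi 0 t - \sum_(i < n.+1) phi i 0 * (rc t ^+ i / i`!%:R).
pose dpsi t := phi 1 t - \sum_(i < n) phi i.+1 0 * (rc t ^+ i / i`!%:R).
have psi0 : psi 0 = 0.
  rewrite /psi big_ord_recl expr0 fact0 divr1 mulr1 big1 ?addr0 ?subrr // => i _.
  by rewrite rc0 expr0n /= mul0r mulr0.
have dpsiE t : 0 <= t <= 1 -> cderiv psi t (dpsi t).
  move=> t01; rewrite /psi /dpsi.
  have D0 := dphi 0 t isT t01.
  have D1 (i : 'I_n.+1) : cderiv (fun t => - phi i 0 / i`!%:R * rc t ^+ i) t
     (- phi i 0 / i`!%:R * (i%:R * rc t ^+ i.-1 * rc 1)).
    by apply/cderivMl/cderivX/cderiv_rc; exact: is_derive_id.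
  apply: cderiv_eq (cderivD D0 (cderiv_sum D1)) => [t'|].
    by congr (_ + _); rewrite -sumrN; apply: eq_bigr => i _; ring.
  congr (_ + _); rewrite big_ord_recl /= mul0r mul0r mulr0 add0r -sumrN.
  apply: eq_bigr => i _; rewrite rc1 mulr1 /bump /= add1n /= factS natrM.
  have i0 : (i`!%:R : C R) != 0 by rewrite pnatr_eq0 -lt0n fact_gt0.
  have i1 : (1 + i%:R : C R) != 0 by rewrite -[1]/(1%:R) -natrD pnatr_eq0.
  by field; apply/andP.
case/andP: s01 => s0 s1.
have := @cderiv_mvt psi dpsi s B s0.
rewrite psi0 subr0 => H; apply: le_trans (H _ _) _.
- by move=> t /andP[t0 ts]; apply: dpsiE; rewrite t0 (le_trans ts).
- move=> t /andP[t0 ts]; apply: (IH (fun i => phi i.+1)).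
  + by rewrite t0 (le_trans ts).
  + by move=> i t' ni; apply: dphi.
  + by move=> t'; apply: bd.
- by rewrite ler_rc ler_piMr.
Qed.

End ComplexNumbers.

(** * Expansions and removable singularities *)

Section Expansions.
Variable K : numClosedFieldType.
Implicit Types (z w p h q : K) (F G : K -> K).

Lemma derivable_expansion F p (a B : K) : 0 <= B ->
  (\forall h \near (0 : K), `|F (p + h) - F p - a * h| <= B * `|h| ^+ 2) ->
  derivable F p 1.
Proof.
move=> B0 H; apply/cvg_ex; exists a; apply/cvgrPdist_le => e e0.
(* [B + 1] keeps the radius [e / (B + 1)] meaningful when [B = 0]. *)
have B1 : 0 < B + 1 by rewrite ltr_wpDl.
near=> h.
have h0 : h != 0 by near: h; exact: nbhs_dnbhs_neq.
have hH : `|F (p + h) - F p - a * h| <= B * `|h| ^+ 2.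
  by near: h; apply: cvg_within; exact: H.
have he : `|h| < e / (B + 1).
  by near: h; apply: dnbhs0_lt; rewrite divr_gt0.
rewrite /= -[h *: 1]/(h * 1) mulr1 [h + p]addrC.
have -> : a - h^-1 *: (F (p + h) - F p) = - (h^-1 * (F (p + h) - F p - a * h)).
  by rewrite /GRing.scale /=; field.
rewrite normrN normrM normfV.
have nh : 0 < `|h| by rewrite normr_gt0.
rewrite ler_pdivrMl // (le_trans hH) // expr2 mulrA mulrC ler_wpM2l //.
move: he; rewrite ltr_pdivlMr // => /ltW; apply: le_trans.
by rewrite mulrC ler_wpM2l // lerDl.
Unshelve. all: by end_near.
Qed.

(* A third-order expansion is what the removal of a singularity costs: it
   gives the second-order expansion of (F z - F p) / (z - p) at p. *)
Definition expands F p := exists a b B : K, 0 <= B /\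
  \forall h \near (0 : K),
    `|F (p + h) - (F p + a * h + b * h ^+ 2)| <= B * `|h| ^+ 3.

Lemma near0_le1 : \forall h \near (0 : K), `|h| <= 1.
Proof. exact: nbhs0_le. Qed.

Lemma expands_derivable F p : expands F p -> derivable F p 1.
Proof.
move=> [a [b [B [B0 H]]]].
apply: (@derivable_expansion F p a (`|b| + B)); first by rewrite addr_ge0.
near=> h.
have hH : `|F (p + h) - (F p + a * h + b * h ^+ 2)| <= B * `|h| ^+ 3.
  by near: h.
have h1 : `|h| <= 1 by near: h; exact: near0_le1.
have -> : F (p + h) - F p - a * h =
  b * h ^+ 2 + (F (p + h) - (F p + a * h + b * h ^+ 2)) by ring.
apply: le_trans (ler_normD _ _) _.
rewrite mulrDl normrM normrX lerD2l (le_trans hH) // exprS mulrA.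
by rewrite ler_wpM2r ?exprn_ge0 // ler_piMr.
Unshelve. all: by end_near.
Qed.

Definition slope F p (a : K) z := if z == p then a else (F z - F p) / (z - p).

Lemma near_neq p z : z != p -> \forall y \near z, y != p.
Proof.
move=> zp; have zp0 : 0 < `|z - p| by rewrite normr_gt0 subr_eq0.
near=> y; apply/eqP => yp.
have : `|z - y| < `|z - p|.
  by near: y; exact: nbhsx_ballx.
by rewrite yp ltxx.
Unshelve. all: by end_near.
Qed.

Lemma derivable_add F G z : derivable F z 1 -> derivable G z 1 ->
  derivable (fun y => F y + G y) z 1.
Proof. exact: derivableD. Qed.

Lemma derivable_mul F G z : derivable F z 1 -> derivable G z 1 ->
  derivable (fun y => F y * G y) z 1.
Proof. exact: derivableM. Qed.

Lemma derivable_sub_cst F q z : derivable F z 1 ->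
  derivable (fun y => F y - q) z 1.
Proof.
by move=> dF; apply: derivable_add => //; exact: derivable_cst.
Qed.

Lemma derivable_id_sub q z : derivable (fun y : K => y - q) z 1.
Proof.
apply: (@derivable_sub_cst id); exact: derivable_id.
Qed.

Lemma derivable_big (n : nat) (F : nat -> K -> K) z :
  (forall i, (i < n)%N -> derivable (F i) z 1) ->
  derivable (fun y => \sum_(i < n) F i y) z 1.
Proof.
elim: n => [_|n IH dF].
  rewrite (_ : (fun y => _) = cst 0); first exact: derivable_cst.
  by apply/funext => y; rewrite big_ord0.
rewrite (_ : (fun y => _) = (fun y => \sum_(i < n) F i y + F n y)).
  apply: derivable_add; last exact: dF.
  by apply: IH => i ni; apply: dF; rewrite ltnS ltnW.
by apply/funext => y; rewrite big_ord_recr.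
Qed.

Lemma derivable_shift F q z : derivable F (z - q) 1 ->
  derivable (fun y => F (y - q)) z 1.
Proof.
rewrite /derivable => H.
rewrite [X in cvg (X @ _)](_ : _ =
  (fun h => h^-1 *: ((F \o shift (z - q)) (h *: 1) - F (z - q)))) //.
by apply/funext => h; rewrite /= addrA.
Qed.

Lemma derivable_quotient F p z : z != p -> derivable F z 1 ->
  derivable (fun y => F y / (y - p)) z 1.
Proof.
move=> zp dF; apply: derivable_mul => //.
apply: derivableV; first by rewrite subr_eq0.
exact: derivable_id_sub.
Qed.

Lemma derivable_slope F p a z :
  z != p -> derivable F z 1 -> derivable (slope F p a) z 1.
Proof.
move=> zp dF.
apply: (@near_eq_derivable _ _ _ (fun y => (F y - F p) * (y - p)^-1)).
  by near=> y; rewrite /slope ifN //; near: y; exact: near_neq.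
by apply: (@derivable_quotient (fun y => F y - F p)) => //; exact: derivable_sub_cst.
Unshelve. all: by end_near.
Qed.

(** At [p] itself, dividing the third-order expansion by [h] leaves a second-order one for the
    slope, with derivative [b]; at other points the quotient rule suffices. *)
Lemma removable_slope F p : expands F p ->
  (\forall z \near p, derivable F z 1) ->
  exists a, \forall z \near p, derivable (slope F p a) z 1.
Proof.
move=> [a [b [B [B0 H]]]] hF; exists a; near=> z.
have [->|zp] := eqVneq z p; last first.
  by apply: derivable_slope => //; near: z.
apply: (@derivable_expansion _ _ b B) => //.
near=> h; rewrite {2}/slope eqxx.
have [->|h0] := eqVneq h 0.
  by rewrite addr0 /slope eqxx mulr0 subrr subrr normr0 expr0n mulr0.
rewrite /slope ifN; last by rewrite -subr_eq0 addrAC subrr add0r.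
have -> : (F (p + h) - F p) / (p + h - p) - a - b * h =
   h^-1 * (F (p + h) - (F p + a * h + b * h ^+ 2)).
  have -> : p + h - p = h by ring.
  by field.
rewrite normrM normfV ler_pdivrMl ?normr_gt0 // [leRHS]mulrCA -exprS.
by near: h.
Unshelve. all: by end_near.
Qed.

Lemma near_sub p q (P : K -> Prop) :
  (\forall z \near (p - q), P z) -> \forall z \near p, P (z - q).
Proof.
move=> /nbhs_ballP[e /= e0 He]; near=> z; apply: He.
have -> : ball (p - q) e (z - q) = ball p e z.
  by rewrite -!ball_normE /= opprB addrA subrK.
by near: z; exact: nbhsx_ballx.
Unshelve. all: by end_near.
Qed.

Lemma derivable_near_shift F p q :
  (\forall z \near (p - q), derivable F z 1) ->
  \forall z \near p, derivable (fun y => F (y - q)) z 1.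
Proof.
by move=> /near_sub; apply: filterS => z; exact: derivable_shift.
Qed.

Lemma derivable_opp F z : derivable F z 1 -> derivable (fun y => - F y) z 1.
Proof. exact: derivableN. Qed.

End Expansions.

(** * Convergence of complex sequences and uniform estimates *)

Section Sequences.
Variable R : realType.

(** A positive element of [C R] has zero imaginary part, so testing convergence with real [e] loses
    nothing. *)
Lemma ccvgP {T : Type} {Fi : set_system T} {FF : Filter Fi} (f : T -> C R)
    (y : C R) :
  (forall e : R, 0 < e -> \forall t \near Fi, `|y - f t| <= rc e) ->
  f t @[t --> Fi] --> y.
Proof.
move=> H; apply/cvgrPdist_le => e e0.
have eE : e = rc (complex.Re e).
  by move: e0; case: e => a b; rewrite ltcE /= => /andP[/eqP -> _].
by rewrite eE; apply: H; rewrite -ltr_rc -eE rc0.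
Qed.

Lemma norm_squeeze0 (u : nat -> C R) (v : nat -> R) :
  (forall n, `|u n| <= rc (v n)) -> v @ \oo --> (0 : R) -> u @ \oo --> rc 0.
Proof.
move=> uv v0; apply: ccvgP => e e0; near=> n.
rewrite rc0 sub0r normrN (le_trans (uv n)) // ler_rc.
rewrite (le_trans (ler_norm _)) // -[v n]subr0 distrC.
by near: n; apply: cvgr_dist_le.
Unshelve. all: by end_near.
Qed.

Lemma cvg_ReIm (u : nat -> C R) (a b : R) :
  (fun n => complex.Re (u n)) @ \oo --> a ->
  (fun n => complex.Im (u n)) @ \oo --> b -> u @ \oo --> (Complex a b : C R).
Proof.
move=> ua ub; apply: ccvgP => e e0; near=> n.
apply: le_trans (norm_le_ReIm _) _; rewrite ler_rc ReD ImD ReN ImN /=.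
rewrite [e]splitr lerD //; near: n; apply: cvgr_dist_le => //; exact: divr_gt0.
Unshelve. all: by end_near.
Qed.

(** Both [v] and [u + v] are nonincreasing and bounded below, so [u] is the difference of two
    convergent sequences. *)
Lemma real_cvg_telescope (u v : nat -> R) :
  (forall n, `|u n.+1 - u n| <= v n - v n.+1) -> (forall n, 0 <= v n) ->
  cvgn u.
Proof.
move=> uv v0.
have vd n : v n.+1 <= v n by rewrite -subr_ge0 (le_trans _ (uv n)).
have cv : cvgn v.
  apply: nonincreasing_is_cvgn; first exact/nonincreasing_seqP.
  by exists 0 => _ [n _ <-].
have ub n : v n - v 0%N <= u n - u 0%N.
  elim: n => [|n IH]; first by rewrite !subrr.
  by have := uv n; rewrite ler_norml => /andP[]; lra.
have cuv : cvgn (fun n => u n + v n).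
  apply: nonincreasing_is_cvgn.
    apply/nonincreasing_seqP => n.
    by have := uv n; rewrite ler_norml => /andP[]; lra.
  exists (u 0%N - v 0%N) => _ [n _ <-].
  by have := ub n; have := v0 n; lra.
rewrite (_ : u = (fun n => u n + v n) \- v); first exact: is_cvgB.
by apply/funext => n /=; lra.
Qed.

Lemma cvg_telescope (u : nat -> C R) (v : nat -> R) :
  (forall n, `|u n.+1 - u n| <= rc (v n - v n.+1)) -> (forall n, 0 <= v n) ->
  exists l : C R, u @ \oo --> l.
Proof.
move=> uv v0.
have cR : cvgn (fun n => complex.Re (u n)).
  apply: (@real_cvg_telescope _ v) => // n.
  by rewrite -ReN -ReD -ler_rc (le_trans (Re_le_norm _)).
have cI : cvgn (fun n => complex.Im (u n)).
  apply: (@real_cvg_telescope _ v) => // n.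
  by rewrite -ImN -ImD -ler_rc (le_trans (Im_le_norm _)).
by eexists; apply: cvg_ReIm; [exact: cR|exact: cI].
Qed.

Lemma telescope_bound (u : nat -> C R) (v : nat -> R) n :
  (forall n, `|u n.+1 - u n| <= rc (v n - v n.+1)) -> (forall n, 0 <= v n) ->
  `|u n| <= `|u 0%N| + rc (v 0%N).
Proof.
move=> uv v0.
(* Keeping [- v n] in the bound is what makes the induction telescope. *)
suff H : `|u n| <= `|u 0%N| + rc (v 0%N - v n).
  by apply: le_trans H _; rewrite lerD2l ler_rc gerBl.
elim: n => [|n IH]; first by rewrite subrr rc0 addr0.
have -> : u n.+1 = u n + (u n.+1 - u n) by ring.
apply: le_trans (ler_normD _ _) _; apply: le_trans (lerD IH (uv n)) _.
by rewrite -addrA -rcD lerD2l ler_rc; lra.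
Qed.

(** Taylor's formula along the segment from [p] to [p + h], where the i-th derivative carries a
    factor [h ^+ i]. Complex expansions thereby reduce to derivatives in a real parameter. *)
Lemma expansion_chain (Fs : nat -> C R -> C R) p h (B : R) :
  (forall i z k (t : R), (i < 3)%N ->
     cderiv (fun s => Fs i (z + rc s * k)) t (k * Fs i.+1 (z + rc t * k))) ->
  (forall k, `|k| <= 1 -> `|Fs 3 (p + k)| <= rc B) -> `|h| <= 1 ->
  `|Fs 0 (p + h) - (Fs 0 p + Fs 1 p * h + Fs 2 p / 2 * h ^+ 2)|
    <= rc B * `|h| ^+ 3.
Proof.
move=> dF bF h1.
have [->|h0] := eqVneq h 0.
  by rewrite addr0 expr0n !mulr0 !addr0 subrr normr0 expr0n mulr0.
have nh : 0 < `|h| by rewrite normr_gt0.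
have nhE : `|h| = rc (complex.Re `|h|) by rewrite norm_rcE.
rewrite [in leRHS]nhE -rcX -rcM.
have := @ctaylor R 3 (fun i t => h ^+ i * Fs i (p + rc t * h)) 1
  (B * complex.Re `|h| ^+ 3).
rewrite [X in `|_ - X|](_ : _ =
    Fs 0 p + Fs 1 p * h + Fs 2 p / 2 * h ^+ 2); last first.
  rewrite !big_ord_recl big_ord0 /= rc0 rc1 mul0r addr0 !expr1n.
  rewrite (_ : bump 0 0 = 1%N) // (_ : bump 0 (bump 0 0) = 2%N) //.
  by rewrite !factS fact0 !muln1 expr0 expr1; field.
rewrite rc1 mul1r expr0 mul1r; apply.
- by rewrite lexx ler01.
- move=> i t i3 _; apply: cderiv_eq (cderivMl (h ^+ i) (dF i p h t i3)) => //.
  by rewrite exprSr mulrA.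
- move=> t /andP[t0 t1]; rewrite normrM normrX nhE -rcX mulrC rcM ler_wpM2r //.
    by rewrite -rc0 ler_rc exprn_ge0 // -ler_rc -nhE rc0.
  apply: bF; rewrite normrM norm_rc [`|t|]ger0_norm //; apply: le_trans h1.
  by rewrite ler_piMl // -rc1 ler_rc.
Qed.

Lemma norm_lim_le (u : nat -> C R) (l : C R) (B : R) :
  u @ \oo --> l -> (forall n, `|u n| <= rc B) -> `|l| <= rc B.
Proof.
move=> ul uB; rewrite norm_rcE ler_rc; apply/ler_addgt0Pr => e e0.
rewrite -ler_rc -norm_rcE.
have re : 0 < rc e by rewrite -rc0 ltr_rc.
have [N _ /(_ N (leqnn N)) /= H] := (cvgrPdist_le _ _).1 ul _ re.
have -> : l = u N + (l - u N) by ring.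
by rewrite rcD (le_trans (ler_normD _ _)) // lerD.
Qed.

End Sequences.

(** * The functions t |-> (ln t)^i t^(-z) *)

Section PowerFunctions.
Variable R : realType.
Implicit Types (z w h : C R) (i j : nat) (s t x rho : R).

(** The exponent [i] records differentiation in [z]: the i-th derivative of $t^{-z}$ in $z$ is
    $(-1)^i(\ln t)^i t^{-z}$. *)
Definition logpow i z t : C R := rc (ln t) ^+ i * cexp (- z * rc (ln t)).

(* dlogpow j i z is the j-th derivative of t |-> (ln t)^i t^(-z). *)
Fixpoint dlogpow j i z t : C R :=
  if j is j'.+1 then
    i%:R * dlogpow j' i.-1 (z + 1) t - z * dlogpow j' i (z + 1) t
  else logpow i z t.

Lemma logpow_cpow z t : logpow 0 z t = (cpow t z)^-1.
Proof. by rewrite /logpow expr0 mul1r mulNr cexpN mulrC. Qed.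

Lemma logpowD1 i z t : 0 < t -> logpow i (z + 1) t = logpow i z t * rc t^-1.
Proof.
move=> t0; rewrite /logpow -mulrA; congr (_ * _).
rewrite opprD mulrDl cexpD mulN1r -rcN cexp_rc expRN lnK //.
Qed.

Lemma cderiv_logpow i z t s : 0 < t + s ->
  cderiv (fun u => logpow i z (t + u)) s (dlogpow 1 i z (t + s)).
Proof.
move=> ts0.
have dln : is_derive s 1 (fun u => ln (t + u)) (t + s)^-1.
  have dt : is_derive s 1 (fun u : R => t + u) 1.
    apply: is_derive_eq (is_deriveD (is_derive_cst t s 1) (is_derive_id s 1)) _.
    by rewrite add0r.
  have : is_derive s 1 ((@ln R) \o (fun u : R => t + u)) ((t + s)^-1 * 1).
    by apply: is_derive1_comp; exact: is_derive1_ln.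
  by rewrite mulr1.
have dL := cderiv_rc dln.
apply: cderiv_eq (cderivM (cderivX i dL) (cderiv_cexp (cderivMl (- z) dL))) => //=.
rewrite !logpowD1 // /logpow.
by ring.
Qed.

Lemma cderiv_dlogpow j i z t s : 0 < t + s ->
  cderiv (fun u => dlogpow j i z (t + u)) s (dlogpow j.+1 i z (t + s)).
Proof.
move=> ts0; elim: j i z => [|j IH] i z; first exact: cderiv_logpow.
apply: cderiv_eq (cderivD (cderivMl i%:R (IH i.-1 (z + 1)))
  (cderivMl (- z) (IH i (z + 1)))) => [u|]; rewrite mulNr //.
Qed.

(** Derivatives in [z] and in [t] commute. In the induction, differentiating the factor [z] yields
    one more copy of [dlogpow j i], which turns the coefficient [i] into [i + 1]. *)
Lemma cderiv_dlogpow_z j i z h t s :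
  cderiv (fun u => dlogpow j i (z + rc u * h) t) s
    (- h * dlogpow j i.+1 (z + rc s * h) t).
Proof.
have did q : cderiv (fun u => q + rc u * h) s h.
  apply: cderiv_eq (cderivD (cderiv_cst q s)
    (cderivMl h (cderiv_rc (is_derive_id s 1)))) => [u|]; first by rewrite mulrC.
  by rewrite rc1 mulr1 add0r.
elim: j i z => [|j IH] i z /=.
  apply: cderiv_eq (cderivMl (rc (ln t) ^+ i)
    (cderiv_cexp (cderivMl (- rc (ln t)) (did z)))) => [u|].
    by rewrite /logpow; congr (_ * cexp _); ring.
  rewrite /logpow exprS (_ : - (z + rc s * h) * rc (ln t) =
    - rc (ln t) * (z + rc s * h)); last by ring.
  by ring.
have IHs i' : cderiv (fun u => dlogpow j i' (z + rc u * h + 1) t) s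
    (- h * dlogpow j i'.+1 (z + rc s * h + 1) t).
  apply: cderiv_eq (IH i' (z + 1)) => [u|]; congr dlogpow || congr (_ * dlogpow _ _ _ _);
    by rewrite addrAC.
apply: cderiv_eq (cderivD (cderivMl i%:R (IHs i.-1))
   (cderivM (cderivMl (-1) (did z)) (IHs i))) => [u|].
  by rewrite mulN1r mulNr.
(* At [i = 0] the truncated [i.-1] sits behind the coefficient 0. *)
case: i => [|i] /=; first by ring.
by rewrite [i.+2%:R]mulrSr; ring.
Qed.

(** The recursion multiplies by [i] and by [z] and moves to [z + 1], so each step costs a factor at
    most [i + rho + j]: raising [rho] by 1 while lowering [j] by 1 leaves this sum unchanged. The
    base $1+|\ln t|$ is at least 1, so a smaller [i] only helps. *)
Lemma dlogpow_bound j i z t rho : `|z| <= rc rho ->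
  `|dlogpow j i z t| <= rc ((i%:R + rho + j%:R) ^+ j *
     ((1 + `|ln t|) ^+ i * expR (- (complex.Re z + j%:R) * ln t))).
Proof.
elim: j i z rho => [|j IH] i z rho zr.
  rewrite /= /logpow normrM normrX norm_rc norm_cexp -rcX -rcM ler_rc.
  rewrite expr0 mul1r addr0 [- z * _]mulrC Re_rcM ReN [ln t * _]mulrC.
  rewrite ler_wpM2r ?expR_ge0 // lerXn2r ?nnegrE //.
  by rewrite lerDr.
have z1r : `|z + 1| <= rc (rho + 1).
  by rewrite rcD rc1 (le_trans (ler_normD _ _)) // normr1 lerD2r.
have rho0 := norm_le_rc_ge0 zr.
set E := (1 + `|ln t|) ^+ i * expR (- (complex.Re z + j.+1%:R) * ln t).
set A := i%:R + rho + j.+1%:R.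
have E0 : 0 <= E by rewrite mulr_ge0 ?expR_ge0 // exprn_ge0.
have A0 : 0 <= A by rewrite !addr_ge0.
have ReE : complex.Re (z + 1) + j%:R = complex.Re z + j.+1%:R.
  by rewrite ReD /= -addrA -[j.+1%:R]nat1r.
have B1 : `|i%:R * dlogpow j i.-1 (z + 1) t| <= rc (i%:R * (A ^+ j * E)).
  case: (i) @E @A E0 A0 => [|k] E A E0 A0; first by rewrite !mul0r normr0 rc0.
  rewrite normrM normr_nat rcM rcn ler_wpM2l // (le_trans (IH _ _ _ z1r)) //.
  rewrite ler_rc /= ReE /A /E.
  apply: ler_pM; rewrite ?mulr_ge0 ?exprn_ge0 ?addr_ge0 ?expR_ge0 //.
    apply: lerXn2r; rewrite ?nnegrE ?addr_ge0 //.
    by rewrite -[k.+1%:R]nat1r -[j.+1%:R]nat1r; lra.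
  rewrite ler_wpM2r ?expR_ge0 // exprS ler_peMl ?exprn_ge0 ?addr_ge0 //.
  by rewrite lerDl.
have B2 : `|z * dlogpow j i (z + 1) t| <= rc (rho * (A ^+ j * E)).
  rewrite normrM rcM; apply: ler_pM => //; apply: le_trans (IH _ _ _ z1r) _.
  rewrite ler_rc ReE -/E ler_wpM2r // lerXn2r ?nnegrE ?addr_ge0 //.
  by rewrite /A -[j.+1%:R]nat1r; lra.
rewrite /= (le_trans (ler_normB _ _)) // (le_trans (lerD B1 B2)) //.
rewrite -rcD ler_rc -mulrDl exprS -!mulrA.
rewrite ler_wpM2r ?mulr_ge0 ?exprn_ge0 // /A.
by rewrite lerDl.
Qed.

End PowerFunctions.

(** * Euler-Maclaurin remainder *)

Section EulerMaclaurin.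
Variable R : realType.
Implicit Types (z w : C R) (i j J n m : nat) (s t : R).

Lemma triangular_sum J (f : nat -> nat -> C R) :
  \sum_(0 <= j < J) \sum_(j <= m < J) f j m =
  \sum_(0 <= m < J) \sum_(0 <= j < m.+1) f j m.
Proof.
elim: J => [|J IH]; first by rewrite !big_nil.
rewrite big_nat_recr //= big_nat1 [RHS]big_nat_recr //= -IH.
rewrite [X in _ = _ + X]big_nat_recr //= addrA.
congr (_ + _); rewrite -big_split /= big_nat [RHS]big_nat.
by apply: eq_bigr => j /andP[_ jJ]; rewrite big_nat_recr //= ltnW.
Qed.

(* The Euler-Maclaurin coefficients: b_j = B_j / j!. *)
Fixpoint bernoulli_seq n : seq R :=
  if n is n'.+1 then
    let s := bernoulli_seq n' in
    rcons s ((n' == 0%N)%:R - \sum_(0 <= j < n') s`_j / (n'.+1 - j)`!%:R)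
  else [::].

Definition bernoulli n := (bernoulli_seq n.+1)`_n.

Lemma size_bernoulli_seq n : size (bernoulli_seq n) = n.
Proof. by elim: n => //= n IH; rewrite size_rcons IH. Qed.

Lemma nth_bernoulli_seq n j : (j < n)%N -> (bernoulli_seq n)`_j = bernoulli j.
Proof.
elim: n => // n IH; rewrite ltnS leq_eqVlt => /predU1P[->//|jn].
by rewrite /= nth_rcons size_bernoulli_seq jn IH.
Qed.

(** Coefficientwise, this is $\frac{x}{e^x-1}\cdot\frac{e^x-1}{x}=1$. *)
Lemma bernoulli_sum m :
  \sum_(0 <= j < m.+1) bernoulli j / (m.+1 - j)`!%:R = (m == 0%N)%:R.
Proof.
rewrite big_nat_recr //= subSnn divr1 {2}/bernoulli /= nth_rcons.
rewrite size_bernoulli_seq ltnn eqxx addrC [X in _ - X + _](_ : _ =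
  \sum_(0 <= j < m) bernoulli j / (m.+1 - j)`!%:R) ?subrK //.
rewrite big_nat [RHS]big_nat; apply: eq_bigr => j /andP[_ jm].
by rewrite nth_bernoulli_seq.
Qed.

Lemma bernoulli0 : bernoulli 0 = 1.
Proof. by rewrite /bernoulli /= big_nil subr0. Qed.

Definition em_rem J i w t : C R := dlogpow 1 i w t -
  \sum_(0 <= j < J) rc (bernoulli j) * (dlogpow j i w (t + 1) - dlogpow j i w t).

Definition bernoulli_norm J := \sum_(0 <= j < J) `|bernoulli j|.

Lemma bernoulli_norm_ge0 J : 0 <= bernoulli_norm J.
Proof. exact: sumr_ge0. Qed.

(** Taylor expansion of each difference produces derivatives of order at most [J], up to an error
    governed by order [J + 1]; by [bernoulli_sum] all of them cancel except the first derivative. *)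
Lemma em_rem_bound J i w t (B : R) : (0 < J)%N -> 0 < t ->
  (forall s, 0 <= s <= 1 -> `|dlogpow J.+1 i w (t + s)| <= rc B) ->
  `|em_rem J i w t| <= rc (bernoulli_norm J * B).
Proof.
move=> J0 t0 bd.
pose g j := dlogpow j i w t.
(* The expansion of [dlogpow j] stops at order [J + 1 - j], so that every error is a derivative of
   the same order [J + 1]. *)
have T j : (j < J)%N -> `|dlogpow j i w (t + 1) - g j -
    \sum_(j <= m < J) g m.+1 / (m.+1 - j)`!%:R| <= rc B.
  move=> jJ; pose phi k s := dlogpow (j + k) i w (t + s).
  have dphi k s : (k < J.+1 - j)%N -> 0 <= s <= 1 ->
      cderiv (phi k) s (phi k.+1 s).
    move=> _ /andP[s0 _]; rewrite /phi addnS; apply: cderiv_dlogpow.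
    by rewrite ltr_wpDr.
  have bphi s : 0 <= s <= 1 -> `|phi (J.+1 - j)%N s| <= rc B.
    by rewrite /phi subnKC ?(leqW (ltnW jJ)) //; exact: bd.
  have h01 : 0 <= (1 : R) <= 1 by rewrite lexx ler01.
  have := ctaylor h01 dphi bphi.
  have -> : \sum_(k < J.+1 - j) phi k 0 * (rc 1 ^+ k / k`!%:R) =
      g j + \sum_(j <= m < J) g m.+1 / (m.+1 - j)`!%:R.
    rewrite subSn ?(ltnW jJ) // big_ord_recl /phi addn0 addr0.
    rewrite expr0 fact0 divr1 mulr1.
    congr (_ + _); rewrite -[X in \sum_(X <= _ < _) _]add0n big_addn big_mkord.
    apply: eq_bigr => k _; rewrite lift0 rc1 expr1n mul1r /g addnS.
    by rewrite -[X in _ = _ / (X - _)`!%:R]addSn addnK addnC.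
  by rewrite opprD addrA /phi addn0.
have E : \sum_(0 <= j < J) rc (bernoulli j) *
    \sum_(j <= m < J) g m.+1 / (m.+1 - j)`!%:R = g 1%N.
  under eq_bigr do rewrite mulr_sumr.
  rewrite triangular_sum.
  have E1 m : \sum_(0 <= j < m.+1) rc (bernoulli j) *
      (g m.+1 / (m.+1 - j)`!%:R) = (m == 0%N)%:R * g m.+1.
    rewrite -[(m == 0%N)%:R]rcn -bernoulli_sum !big_mkord rc_sum mulr_suml.
    by apply: eq_bigr => j _; rewrite rcM rcV rcn; ring.
  under eq_bigr do rewrite E1.
  (* Only [m = 0] survives, and it lies in the range because [0 < J]. *)
  rewrite big_ltn // mul1r big_nat big1 ?addr0 // => m /andP[m1 _].
  by rewrite gtn_eqF // mul0r.
rewrite /em_rem -/(g 1%N) -E -sumrB.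
under eq_bigr do rewrite -mulrBr.
rewrite (le_trans (ler_norm_sum _ _ _)) //.
rewrite /bernoulli_norm mulr_suml [in leRHS]big_mkord rc_sum [leLHS]big_mkord.
apply: ler_sum => j _; rewrite normrM norm_rc rcM ler_wpM2l //.
  by rewrite -rc0 ler_rc.
by rewrite distrC; apply: T.
Qed.

End EulerMaclaurin.

(** * The Hurwitz zeta function *)

Section LimitRules.
Variable K : numClosedFieldType.
Implicit Types (u v : nat -> K) (a b k : K).

Lemma cvgn_add u v a b : u @ \oo --> a -> v @ \oo --> b ->
  (fun n => u n + v n) @ \oo --> a + b.
Proof. exact: cvgD. Qed.

Lemma cvgn_scale u a k : u @ \oo --> a -> (fun n => k * u n) @ \oo --> k * a.
Proof. by move=> ua; apply: cvgM => //; exact: cvg_cst. Qed.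

Lemma cvgn_sum (I : nat) (u : nat -> nat -> K) (a : nat -> K) :
  (forall j, (j < I)%N -> u j @ \oo --> a j) ->
  (fun n => \sum_(0 <= j < I) u j n) @ \oo --> \sum_(0 <= j < I) a j.
Proof.
elim: I => [_|I IH H].
  rewrite big_nil (_ : (fun n => _) = fun=> 0); first exact: cvg_cst.
  by apply/funext => n; rewrite big_nil.
rewrite big_nat_recr //= (_ : (fun n => _) =
  (fun n => \sum_(0 <= j < I) u j n + u I n)).
  by apply: cvgn_add; [apply: IH => j jI; apply: H; exact: ltnW|exact: H].
by apply/funext => n; rewrite big_nat_recr.
Qed.

Lemma cvgn_unique u a b : u @ \oo --> a -> u @ \oo --> b -> a = b.
Proof. by move=> ua ub; rewrite -(cvg_lim _ ua) // -(cvg_lim _ ub). Qed.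

Lemma cvgn_lim_ex u : (exists l : K, u @ \oo --> l) -> u @ \oo --> lim (u @ \oo).
Proof. by move=> [l /cvgP]. Qed.

End LimitRules.

Section HurwitzZeta.
Variables (R : realType) (x : R).
Hypothesis x0 : 0 < x.
Implicit Types (z w p h : C R) (i j J n N : nat) (s t rho : R).

Let shift_gt0 n : 0 < n%:R + x. Proof. by rewrite ltr_wpDl. Qed.

(** On $[x,\infty)$ each factor $1+|\ln t|$ is traded for [log_slope * t], a power of $t$ that the
    decay can absorb. *)
Definition log_slope : R := 1 + (1 + `|ln x|) / x.

Lemma log_slope_ge1 : 1 <= log_slope.
Proof. by rewrite lerDl divr_ge0 ?addr_ge0 // ltW. Qed.

Lemma ln_le_slope t : x <= t -> 1 + `|ln t| <= log_slope * t.
Proof.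
move=> xt; have t0 : 0 < t := lt_le_trans x0 xt.
have H : `|ln t| <= t + `|ln x|.
  (* For $t\ge1$ this is $\ln t<t$; for $x\le t<1$ monotonicity bounds $|\ln t|$ by $|\ln x|$. *)
  have [t1|t1] := leP 1 t.
    rewrite ger0_norm ?ln_ge0 //.
    by rewrite (le_trans (ltW (ln_sublinear t0))) // lerDl.
  rewrite ler0_norm ?ln_le0 ?(ltW t1) //.
  rewrite ler0_norm ?ln_le0 ?(le_trans xt (ltW t1)) //.
  have : ln x <= ln t by rewrite ler_ln ?posrE.
  by lra.
have E : log_slope * t = t + (1 + `|ln x|) * (t / x).
  by rewrite /log_slope; field; rewrite gt_eqF.
rewrite E.
have tx : 1 <= t / x by rewrite ler_pdivlMr // mul1r.
have : 1 + `|ln x| <= (1 + `|ln x|) * (t / x).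
  by rewrite ler_peMr // addr_ge0.
by lra.
Qed.

(** Write $t^{-s}=x^{-s}(x/t)^s$: the base $x/t$ is at most 1 and $s\ge2$, while $x^{-s}\le
    e^{\rho|\ln x|}$. *)
Lemma exp_ln_bound s rho t : 2 <= s -> s <= rho -> x <= t ->
  expR (- s * ln t) <= expR (rho * `|ln x|) * (x ^+ 2 / t ^+ 2).
Proof.
move=> s2 sr xt; have t0 : 0 < t := lt_le_trans x0 xt.
have lxt : ln x <= ln t by rewrite ler_ln ?posrE.
have -> : x ^+ 2 / t ^+ 2 = expR (2 * (ln x - ln t)).
  by rewrite mulrDr expRD mulrN expRN !expRM_natl !lnK ?posrE.
rewrite -expRD ler_expR.
have h1 : - s * ln x <= rho * `|ln x|.
  have : `|- s * ln x| <= rho * `|ln x|.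
    by rewrite normrM normrN ler_wpM2r // ger0_norm //; lra.
  by apply: le_trans; exact: ler_norm.
have : 2 * (ln t - ln x) <= s * (ln t - ln x) by rewrite ler_wpM2r // subr_ge0.
by lra.
Qed.

Definition em_const J rho : R :=
  (3 + rho + J.+1%:R) ^+ J.+1 *
  (log_slope ^+ 3 * (expR ((rho + J.+1%:R) * `|ln x|) * x ^+ 2)).

Lemma em_const_ge0 J rho : 0 <= rho -> 0 <= em_const J rho.
Proof.
move=> r0; have x0' := ltW x0.
have l0 : 0 <= log_slope := le_trans ler01 log_slope_ge1.
apply: mulr_ge0; first by rewrite exprn_ge0 // !addr_ge0.
by apply: mulr_ge0; rewrite ?exprn_ge0 // mulr_ge0 ?expR_ge0 ?exprn_ge0.
Qed.

(** The derivative of order [J + 1] decays like $t^{-\operatorname{Re}w-J-1}$ and the logarithms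
    cost at most three powers of $t$; the threshold 4 leaves the exponent $4+1-3=2$ needed for
    summability. *)
Lemma dlogpow_decay J i w rho t : (i <= 3)%N -> `|w| <= rc rho ->
  4 <= complex.Re w + J%:R -> x <= t ->
  `|dlogpow J.+1 i w t| <= rc (em_const J rho / t ^+ 2).
Proof.
move=> i3 wr wJ xt; have t0 : 0 < t := lt_le_trans x0 xt.
have r0 := norm_le_rc_ge0 wr.
apply: le_trans (dlogpow_bound _ _ _ wr) _; rewrite ler_rc.
have -> : em_const J rho / t ^+ 2 = (3 + rho + J.+1%:R) ^+ J.+1 * (log_slope ^+ 3 *
    (expR ((rho + J.+1%:R) * `|ln x|) * (x ^+ 2 / t ^+ 2))).
  by rewrite /em_const !mulrA.
have iR : i%:R <= 3 :> R by rewrite ler_nat.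
apply: ler_pM; rewrite ?mulr_ge0 ?exprn_ge0 ?expR_ge0 ?addr_ge0 //.
  by rewrite lerXn2r ?nnegrE ?addr_ge0 // !lerD2r.
have l1 := log_slope_ge1; have l0 : 0 <= log_slope := le_trans ler01 l1.
have H1 : (1 + `|ln t|) ^+ i <= log_slope ^+ 3 * t ^+ i.
  have H : (1 + `|ln t|) ^+ i <= (log_slope * t) ^+ i.
    by rewrite lerXn2r ?nnegrE ?addr_ge0 ?mulr_ge0 ?(ltW t0) // ln_le_slope.
  apply: le_trans H _; rewrite exprMn ler_wpM2r ?exprn_ge0 ?(ltW t0) //.
  exact: ler_weXn2l.
apply: le_trans (ler_wpM2r (expR_ge0 _) H1) _.
rewrite -mulrA ler_wpM2l ?exprn_ge0 //.
rewrite -[in t ^+ i](lnK t0) -expRM_natl -expRD -mulrDl.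
rewrite (_ : i%:R + _ = - (complex.Re w + J.+1%:R - i%:R)); last by ring.
have /ler_normlP[_ wr'] := Re_le_rc wr.
have i0 : 0 <= i%:R :> R by [].
by apply: exp_ln_bound => //; rewrite -[J.+1%:R]natr1; lra.
Qed.

(** A multiple of $1/t$, $t=n+x$, whose successive differences dominate terms of size $t^{-2}$; the
    factor $1+1/x$ makes up for $t/(t+1)$ in $1/t-1/(t+1)=t^{-2}\,t/(t+1)$. *)
Definition em_tail J rho n : R :=
  bernoulli_norm R J * em_const J rho * (1 + x^-1) / (n%:R + x).

Lemma em_tail_ge0 J rho n : 0 <= rho -> 0 <= em_tail J rho n.
Proof.
move=> r0; rewrite divr_ge0 ?(ltW (shift_gt0 n)) //.
apply: mulr_ge0; last by rewrite addr_ge0 // invr_ge0 ltW.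
by apply: mulr_ge0; [exact: bernoulli_norm_ge0|exact: em_const_ge0].
Qed.

Lemma em_rem_decay J i w rho n : (0 < J)%N -> (i <= 3)%N -> `|w| <= rc rho ->
  4 <= complex.Re w + J%:R ->
  `|em_rem J i w (n%:R + x)| <= rc (em_tail J rho n - em_tail J rho n.+1).
Proof.
move=> J0 i3 wr wJ; have n0 := shift_gt0 n; set t := n%:R + x.
have t0 : 0 < t := n0.
have r0 := norm_le_rc_ge0 wr.
apply: (@le_trans _ _ (rc (bernoulli_norm R J * (em_const J rho / t ^+ 2)))).
  apply: em_rem_bound => // s /andP[s0 s1].
  have xts : x <= t + s by rewrite /t -addrA addrCA lerDl addr_ge0.
  apply: le_trans (dlogpow_decay i3 wr wJ xts) _.
  have ts : t <= t + s by rewrite lerDl.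
  have ts0 := lt_le_trans t0 ts.
  rewrite ler_rc; apply: ler_wpM2l; first exact: em_const_ge0.
  by rewrite lef_pV2 ?posrE ?exprn_gt0 // lerXn2r ?nnegrE //; exact: ltW.
have tE : n.+1%:R + x = t + 1 by rewrite /t -natr1; ring.
rewrite ler_rc /em_tail tE -/t.
move: (em_const J rho) (em_const_ge0 J r0) => e e0.
rewrite -mulrBr -!mulrA; apply: ler_wpM2l; first exact: bernoulli_norm_ge0.
apply: ler_wpM2l => //.
have t1 : 0 < t + 1 by lra.
have -> : t^-1 - (t + 1)^-1 = t ^- 2 * (t / (t + 1)).
  by field; rewrite (gt_eqF t0) (gt_eqF t1).
rewrite mulrCA ler_peMr ?invr_ge0 ?exprn_ge0 ?(ltW t0) // mulrA.
rewrite ler_pdivlMr // mul1r mulrDl mul1r lerD2l mulrC ler_pdivlMr // mul1r.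
by rewrite lerDr.
Qed.

(** Summing [em_rem] telescopes the corrections to their two ends. Only the upper end is kept, which
    changes the sum of remainders by a term independent of [N]. *)
Definition em_sum J i w N : C R :=
  \sum_(0 <= n < N) dlogpow 1 i w (n%:R + x) -
  \sum_(0 <= j < J) rc (bernoulli R j) * dlogpow j i w (N%:R + x).

Lemma em_sum_step J i w N :
  em_sum J i w N.+1 - em_sum J i w N = em_rem J i w (N%:R + x).
Proof.
rewrite /em_sum /em_rem big_nat_recr //.
rewrite (_ : N.+1%:R + x = N%:R + x + 1); last by rewrite -natr1; ring.
set t := N%:R + x.
have E : \sum_(0 <= j < J) rc (bernoulli R j) *
      (dlogpow j i w (t + 1) - dlogpow j i w t) =
    \sum_(0 <= j < J) rc (bernoulli R j) * dlogpow j i w (t + 1) -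
    \sum_(0 <= j < J) rc (bernoulli R j) * dlogpow j i w t.
  by rewrite -sumrB; apply: eq_bigr => j _; rewrite mulrBr.
rewrite E; move: (\sum_(0 <= j < J) _ * _) (\sum_(0 <= j < J) _ * _) => S1 S2.
by move: (\sum_(0 <= n < N) _) (dlogpow 1 i w t) => S3 g /=; ring.
Qed.

Lemma em_sum_cvg J i w : (0 < J)%N -> (i <= 3)%N -> 4 <= complex.Re w + J%:R ->
  em_sum J i w @ \oo --> lim (em_sum J i w @ \oo).
Proof.
move=> J0 i3 wJ; apply: cvgn_lim_ex.
have wr : `|w| <= rc (complex.Re `|w|) by rewrite norm_rcE.
apply: (@cvg_telescope _ _ (em_tail J (complex.Re `|w|))) => n.
  by rewrite em_sum_step; apply: em_rem_decay.
exact: em_tail_ge0 (norm_le_rc_ge0 wr).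
Qed.

End HurwitzZeta.

(** * The entire limit function and the continuation of the Hurwitz series *)

Section Continuation.
Variables (R : realType) (x : R).
Hypothesis x0 : 0 < x.
Implicit Types (z w p h : C R) (i j J n N : nat) (s t rho : R).

Lemma expR_ln_cvg0 s : 0 < s ->
  (fun n : nat => expR (- s * ln (n%:R + x))) @ \oo --> (0 : R).
Proof.
move=> s0; apply/cvgrPdist_le => e e0; near=> n.
rewrite sub0r normrN ger0_norm ?expR_ge0 //.
rewrite -[leRHS]lnK ?posrE // ler_expR mulNr lerNl -ler_pdivrMl //.
rewrite -[leLHS]expRK ler_ln ?posrE ?expR_gt0 ?ltr_wpDl //.
apply: (@le_trans _ _ n%:R); last by rewrite lerDl ltW.
by near: n; exact: nbhs_infty_ger.
Unshelve. all: by end_near.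
Qed.

Lemma dlogpow_cvg0 j w : 0 < complex.Re w + j%:R ->
  (fun n : nat => dlogpow j 0 w (n%:R + x)) @ \oo --> rc (0 : R).
Proof.
move=> wj; have wr : `|w| <= rc (complex.Re `|w|) by rewrite norm_rcE.
apply: norm_squeeze0 => [n|]; first exact: dlogpow_bound wr.
rewrite -[X in _ --> X](mulr0 ((0%:R + complex.Re `|w| + j%:R) ^+ j)).
apply: cvgM; first exact: cvg_cst.
under eq_fun do rewrite expr0 mul1r.
exact: expR_ln_cvg0.
Qed.

Lemma em_corr_cvg0 J w : (forall j, (j < J)%N -> 0 < complex.Re w + j%:R) ->
  (fun N => \sum_(0 <= j < J) rc (bernoulli R j) * dlogpow j 0 w (N%:R + x))
    @ \oo --> rc (0 : R).
Proof.
move=> H.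
have -> : rc (0 : R) = \sum_(0 <= j < J) rc (bernoulli R j) * rc 0.
  by rewrite big1 // => j _; rewrite rc0 mulr0.
by apply: cvgn_sum => j jJ; apply: cvgn_scale; apply: dlogpow_cvg0; exact: H.
Qed.

Local Notation emlim J i w := (lim (em_sum x J i w @ \oo)).

(** The one extra correction has size $t^{-\operatorname{Re}w-J}$ and dies in the limit. *)
Lemma emlim_succ J w : (0 < J)%N -> 4 <= complex.Re w + J%:R ->
  emlim J.+1 0 w = emlim J 0 w.
Proof.
move=> J0 wJ; apply: (@cvgn_unique _ (em_sum x J.+1 0 w)).
  by apply: em_sum_cvg => //; rewrite -natr1; lra.
rewrite (_ : em_sum x J.+1 0 w = (fun N => em_sum x J 0 w N +
   (- rc (bernoulli R J)) * dlogpow J 0 w (N%:R + x))).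
  rewrite -[X in _ --> X]addr0 -(mulr0 (- rc (bernoulli R J))) -rc0.
  apply: cvgn_add; first exact: em_sum_cvg.
  by apply: cvgn_scale; apply: dlogpow_cvg0; lra.
apply/funext => N; rewrite /em_sum big_nat_recr //=.
move: (\sum_(0 <= n < N) _) (\sum_(0 <= j < J) _) (dlogpow _ _ _ _) => a b c.
by ring.
Qed.

(** This lets a single [J] serve a whole disk, although [em_entire] chooses its order pointwise. *)
Lemma emlim_indep J J' w : (0 < J)%N -> (0 < J')%N ->
  4 <= complex.Re w + J%:R -> 4 <= complex.Re w + J'%:R ->
  emlim J 0 w = emlim J' 0 w.
Proof.
suff H k : (0 < k)%N -> 4 <= complex.Re w + k%:R -> forall l, (k <= l)%N ->
    emlim l 0 w = emlim k 0 w.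
  move=> J0 J0' wJ wJ'; case: (leqP J J') => [/H->//|/ltnW/H->//].
move=> k0 wk; elim=> [|l IH]; first by rewrite leqn0 => /eqP ->.
rewrite leq_eqVlt => /predU1P[->//|]; rewrite ltnS => kl.
rewrite emlim_succ ?IH // ?(leq_trans k0) //.
by rewrite (le_trans wk) // lerD2l ler_nat.
Qed.

(** The sign $(-1)^i$ absorbs the minus produced by each derivative in [z], giving the chain that
    [expansion_chain] expects. *)
Lemma em_sum_chain J i z h t : (i < 3)%N -> forall N,
  cderiv (fun s => (-1) ^+ i * em_sum x J i (z + rc s * h) N) t
    (h * ((-1) ^+ i.+1 * em_sum x J i.+1 (z + rc t * h) N)).
Proof.
move=> _ N.
have D1 : cderiv (fun s => \sum_(n < N) dlogpow 1 i (z + rc s * h) (n%:R + x)) t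
    (\sum_(n < N) - h * dlogpow 1 i.+1 (z + rc t * h) (n%:R + x)).
  by apply: cderiv_sum => n; exact: cderiv_dlogpow_z.
have D2 : cderiv (fun s => \sum_(j < J) - rc (bernoulli R j) *
      dlogpow j i (z + rc s * h) (N%:R + x)) t
    (\sum_(j < J) - rc (bernoulli R j) *
      (- h * dlogpow j i.+1 (z + rc t * h) (N%:R + x))).
  by apply: cderiv_sum => j; apply: cderivMl; exact: cderiv_dlogpow_z.
apply: cderiv_eq (cderivMl ((-1) ^+ i) (cderivD D1 D2)) => [s|].
  rewrite /em_sum !big_mkord -sumrN; congr (_ * (_ + _)).
  by apply: eq_bigr => j _; rewrite mulNr.
rewrite /em_sum !big_mkord exprSr -mulrA mulrCA; congr (_ * _).
rewrite mulN1r mulrN -mulNr mulrDr mulr_sumr; congr (_ + _).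
rewrite -sumrN mulr_sumr; apply: eq_bigr => j _.
by ring.
Qed.

Lemma dlogpow_locally_bounded j i t rho : exists B : R, 0 <= B /\
  forall w, `|w| <= rc rho -> `|dlogpow j i w t| <= rc B.
Proof.
exists (`|(i%:R + rho + j%:R) ^+ j| *
  ((1 + `|ln t|) ^+ i * expR ((rho + j%:R) * `|ln t|))).
split=> [|w wr]; first by rewrite !mulr_ge0 ?expR_ge0 ?exprn_ge0.
apply: le_trans (dlogpow_bound _ _ _ wr) _; rewrite ler_rc.
have r0 := norm_le_rc_ge0 wr.
rewrite [`|_ ^+ j|]ger0_norm ?exprn_ge0 ?addr_ge0 // ler_wpM2l ?exprn_ge0 ?addr_ge0 //.
rewrite ler_wpM2l ?exprn_ge0 ?addr_ge0 // ler_expR.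
rewrite (le_trans (ler_norm _)) // normrM normrN ler_wpM2r //.
by rewrite (le_trans (ler_normD _ _)) // normr_nat lerD2r Re_le_rc.
Qed.

Lemma em_sum0_bounded J i rho : exists B : R, 0 <= B /\
  forall w, `|w| <= rc rho -> `|em_sum x J i w 0| <= rc B.
Proof.
rewrite /em_sum; elim: J => [|J [B [B0 HB]]].
  by exists 0; split=> // w _; rewrite !big_nil subrr normr0 rc0.
have [A [A0 HA]] := dlogpow_locally_bounded J i (0%:R + x) rho.
exists (B + `|bernoulli R J| * A); split=> [|w wr].
  by rewrite addr_ge0 // mulr_ge0.
rewrite big_nat_recr //= opprD addrA rcD.
apply: le_trans (ler_normB _ _) _; rewrite lerD ?HB //.
by rewrite normrM norm_rc rcM ler_wpM2l ?HA // -rc0 ler_rc.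
Qed.

(** The increments telescope, so the value at [N = 0] and one tail constant bound all [N] at once.
    The index 3 is the order of the Taylor remainder in [w]. *)
Lemma em_sum_locally_bounded J rho : (0 < J)%N -> exists B : R, 0 <= B /\
  forall w N, `|w| <= rc rho -> 4 <= complex.Re w + J%:R ->
    `|em_sum x J 3 w N| <= rc B.
Proof.
move=> J0; have [B [B0 HB]] := em_sum0_bounded J 3 rho.
have [r0|r0] := leP 0 rho; last first.
  by exists 0; split=> // w N /norm_le_rc_ge0; rewrite leNgt r0.
exists (B + em_tail x J rho 0); split; first by rewrite addr_ge0 ?em_tail_ge0.
move=> w N wr wJ; rewrite rcD.
apply: le_trans (@telescope_bound _ _ (em_tail x J rho) N _ _) _.
- by move=> n; rewrite em_sum_step; exact: em_rem_decay.
- by move=> n; exact: em_tail_ge0.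
- by rewrite lerD2r HB.
Qed.

(** The threshold 5 leaves one unit of room, since a step of norm at most 1 can lower the real part
    by 1. The numbers [a] and [2 b] are the limits of the first two derivatives of the partial
    sums. *)
Lemma emlim_expansion J p : (0 < J)%N -> 5 <= complex.Re p + J%:R ->
  exists a b B : C R, 0 <= B /\ forall h, `|h| <= 1 ->
    `|emlim J 0 (p + h) - (emlim J 0 p + a * h + b * h ^+ 2)| <= B * `|h| ^+ 3.
Proof.
move=> J0 pJ.
have pr : `|p| <= rc (complex.Re `|p|) by rewrite norm_rcE.
have [B [B0 HB]] := em_sum_locally_bounded (complex.Re `|p| + 1) J0.
have near_p h : `|h| <= 1 -> 4 <= complex.Re (p + h) + J%:R.
  rewrite -rc1 => /Re_le_rc; rewrite ler_norml ReD => /andP[h1 _]; lra.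
have pJ4 : 4 <= complex.Re p + J%:R by lra.
exists (- emlim J 1 p), (emlim J 2 p / 2), (rc B).
split=> [|h h1]; first by rewrite -rc0 ler_rc.
pose F N i w := (-1) ^+ i * em_sum x J i w N.
have nhE : `|h| = rc (complex.Re `|h|) by rewrite norm_rcE.
rewrite [in leRHS]nhE -rcX -rcM.
pose G N := F N 0%N (p + h) - (F N 0%N p + F N 1%N p * h + F N 2%N p / 2 * h ^+ 2).
apply: (@norm_lim_le _ G); last first.
  move=> N; rewrite rcM rcX -nhE; apply: (@expansion_chain _ (F N)) => //.
  - by move=> i z k t i3; apply: em_sum_chain.
  - move=> k k1; rewrite /F normrM normrX normrN normr1 expr1n mul1r.
    apply: HB; last exact: near_p.
    by rewrite rcD rc1 (le_trans (ler_normD _ _)) // lerD.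
rewrite (_ : G = fun N => em_sum x J 0 (p + h) N + ((-1) * em_sum x J 0 p N +
   (h * em_sum x J 1 p N + (- h ^+ 2 / 2) * em_sum x J 2 p N))); last first.
  apply/funext => N; rewrite /G /F expr0 expr1 -signr_odd expr0 !mul1r mulN1r.
  move: (em_sum _ _ _ _ _) (em_sum _ _ _ _ _) (em_sum _ _ _ _ _)
    (em_sum _ _ _ _ _) => e1 e2 e3 e4.
  by field.
rewrite (_ : emlim J 0 (p + h) - _ = emlim J 0 (p + h) + ((-1) * emlim J 0 p +
   (h * emlim J 1 p + (- h ^+ 2 / 2) * emlim J 2 p))); last by field.
apply: cvgn_add; first by apply: em_sum_cvg => //; exact: near_p.
apply: cvgn_add; first by apply: cvgn_scale; apply: em_sum_cvg.
by apply: cvgn_add; apply: cvgn_scale; apply: em_sum_cvg.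
Qed.

(** Here $\lfloor|\operatorname{Re}w|\rfloor+1$ offsets a negative real part, and the remaining 4 is
    the threshold of [dlogpow_decay]. *)
Definition em_order w := ((Num.truncn `|complex.Re w|) + 5)%N.

Lemma em_order_gt0 w : (0 < em_order w)%N.
Proof. by rewrite /em_order addnS. Qed.

Lemma em_orderP w k : 4 + k%:R <= complex.Re w + (em_order w + k)%:R.
Proof.
have : `|complex.Re w| < (Num.truncn `|complex.Re w|)%:R + 1 :> R.
  by rewrite natr1 truncnS_gt.
rewrite /em_order; move: (Num.truncn _) => T.
have := ler_norm (- complex.Re w); rewrite normrN !natrD.
by lra.
Qed.

(* The entire function - w zeta(w + 1, x). *)
Definition em_entire w : C R := emlim (em_order w) 0 w.

Lemma em_entireE J w : (0 < J)%N -> 4 <= complex.Re w + J%:R ->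
  em_entire w = emlim J 0 w.
Proof.
move=> J0 wJ; apply: emlim_indep => //; first exact: em_order_gt0.
by have := em_orderP w 0; rewrite addr0 addn0.
Qed.

Lemma em_entire_expands p : expands em_entire p.
Proof.
(* One more than the order chosen at [p], hence valid on the whole unit disk around [p]. *)
pose J := (em_order p + 1)%N.
have J0 : (0 < J)%N by rewrite /J addn1.
have pJ : 5 <= complex.Re p + J%:R by have := em_orderP p 1; rewrite -/J; lra.
have [a [b [B [B0 H]]]] := emlim_expansion J0 pJ.
exists a, b, B; split=> //; near=> h.
have h1 : `|h| <= 1 by near: h; exact: near0_le1.
rewrite !(@em_entireE J) //; first exact: H.
  by lra.
move: h1; rewrite -rc1 => /Re_le_rc; rewrite ler_norml ReD => /andP[h1 _].
by lra.
Unshelve. all: by end_near.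
Qed.

Lemma em_entire_derivable p : derivable em_entire p 1.
Proof. exact/expands_derivable/em_entire_expands. Qed.

Lemma dlogpow_const j t : dlogpow j.+1 0 0 t = 0 :> C R.
Proof. by rewrite /= !mul0r subrr. Qed.

(** At [w = 0] the function $t^{-w}$ is constant: its derivatives vanish and every partial sum is
    minus the coefficient [bernoulli 0]. This value is what makes the residue of the Hurwitz zeta
    function 1. *)
Lemma em_entire0 : em_entire 0 = -1.
Proof.
have H := @em_sum_cvg _ _ x0 (em_order 0) 0 0 (em_order_gt0 0) isT.
apply: (@cvgn_unique _ (em_sum x (em_order 0) 0 0)).
  by apply: H; have := em_orderP 0 0; rewrite addr0 addn0.
rewrite (_ : em_sum _ _ _ _ = fun=> -1); first exact: cvg_cst.
apply/funext => N; rewrite /em_sum big1 => [|n _]; last exact: dlogpow_const.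
rewrite (big_ltn (em_order_gt0 0)) big_nat big1 => [|j /andP[j0 _]].
  by rewrite bernoulli0 rc1 /= /logpow expr0 oppr0 mul0r cexp0 mulr1 addr0 sub0r mulr1.
by case: j j0 => // j _; rewrite dlogpow_const mulr0.
Qed.

(** With $w=z-1$ and $\operatorname{Re}w>0$ all corrections, even that of order 0, tend to 0, and
    the first derivative of $t^{-w}$ is $-w\,t^{-w-1}$. *)
Lemma hurwitz_series_cvg z : 1 < complex.Re z ->
  series (fun n => (cpow (n%:R + x) z)^-1) @ \oo -->
    - em_entire (z - 1) / (z - 1).
Proof.
move=> z1; pose w := z - 1.
have w0 : 0 < complex.Re w by rewrite /w ReD ReN -rc1 /=; lra.
have wn0 : w != 0 by apply: contraTneq w0 => ->; rewrite ltxx.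
pose J := em_order w.
have H := @em_sum_cvg _ _ x0 J 0 w (em_order_gt0 w) isT.
have H2 := @em_corr_cvg0 J w (fun j _ => ltr_wpDr (ler0n R j) w0).
rewrite (_ : series _ = fun N => (- w^-1) * (em_sum x J 0 w N +
  \sum_(0 <= j < J) rc (bernoulli R j) * dlogpow j 0 w (N%:R + x))).
  rewrite (_ : - em_entire w / w = (- w^-1) * (em_entire w + rc 0)); last first.
    by rewrite rc0; field.
  have H1 : em_sum x J 0 w @ \oo --> em_entire w.
    by apply: H; have := em_orderP w 0; rewrite addr0 addn0.
  exact: (cvgn_scale (k := - w^-1) (cvgn_add H1 H2)).
apply/funext => N; rewrite /series /= /em_sum subrK mulr_sumr.
apply: eq_bigr => n _; rewrite /dlogpow mul0r sub0r -/(logpow 0 (w + 1) _) logpow_cpow.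
rewrite (_ : w + 1 = z); last by rewrite /w subrK.
by rewrite mulrNN mulrA mulVf // mul1r.
Qed.

Lemma hurwitz_zeta_exists : exists f, is_hurwitz_zeta x f.
Proof.
exists (fun z => - em_entire (z - 1) / (z - 1)); split.
- move=> z z1; rewrite /holomorphic_at; near=> y.
  apply: (@derivable_quotient _ (fun v => - em_entire (v - 1))).
    by near: y; exact: near_neq.
  apply: (@derivable_opp _ (fun v => em_entire (v - 1))).
  by apply: derivable_shift; exact: em_entire_derivable.
(* Since [em_entire 0 = -1], subtracting the pole leaves minus the slope of [em_entire] at 0. *)
- have [|a Ha] := removable_slope (em_entire_expands 0).
    by near=> y; exact: em_entire_derivable.
  exists (fun z => - slope em_entire 0 a (z - 1)).
    move: Ha; rewrite -{1}(subrr 1) => /derivable_near_shift.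
    apply: filterS => z.
    exact: (@derivable_opp _ (fun v => slope em_entire 0 a (v - 1))).
  near=> z; have z1 : z != 1 by near: z; exact: nbhs_dnbhs_neq.
  rewrite big_ord1 /= expr1 /slope subr_eq0 (negbTE z1) em_entire0 subr0.
  have z10 : z - 1 != 0 by rewrite subr_eq0.
  by field.
- exact: hurwitz_series_cvg.
Unshelve. all: by end_near.
Qed.

End Continuation.

(** * Principal parts *)

Section PrincipalParts.
Variable K : numClosedFieldType.
Implicit Types (F G L : K -> K) (p q r s z : K).

Lemma derivable_continuous F p : derivable F p 1 -> F @ p --> F p.
Proof. by move=> /derivable1_diffP /differentiable_continuous. Qed.

Lemma derivable_horner_shift (P : {poly K}) p z :
  derivable (fun y => P.[y - p]) z 1.
Proof.
elim/poly_ind: P => [|P c IH].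
  rewrite (_ : (fun y => _) = cst 0); first exact: derivable_cst.
  by apply/funext => y; rewrite horner0.
rewrite (_ : (fun y => _) = (fun y => P.[y - p] * (y - p) + cst c y)).
  apply: derivable_add; last exact: derivable_cst.
  by apply: derivable_mul; [exact: IH|exact: derivable_id_sub].
by apply/funext => y; rewrite hornerMXaddC.
Qed.

(** Letting [z] tend to [p] kills the constant coefficient, after which a factor [z - p] cancels;
    induction on [n] exhausts the coefficients. *)
Lemma horner_eq0_near (P : {poly K}) n G p : (size P <= n)%N ->
  derivable G p 1 ->
  (\forall z \near p^', P.[z - p] = (z - p) ^+ n * G z) -> P = 0.
Proof.
move=> sP dG; elim: n P sP => [|n IH] P.
  by rewrite size_poly_leq0 => /eqP ->.
elim/poly_ind: P => // Q c _ sP HP.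
(* Near [p] but off it, [F] equals the constant [c], while its formula is continuous with value 0 at
   [p]. *)
pose F z := (z - p) * (('X^n).[z - p] * G z - Q.[z - p]).
have F0 : F @ p^' --> (0 : K).
  have -> : 0 = F p by rewrite /F subrr mul0r.
  apply: cvg_within_filter; apply: derivable_continuous.
  apply: derivable_mul; first exact: derivable_id_sub.
  apply: derivable_add.
    by apply: derivable_mul; [exact: derivable_horner_shift|exact: dG].
  by apply: derivable_opp; exact: derivable_horner_shift.
have c0 : c = 0.
  have Fc : F @ p^' --> c.
    apply: cvg_near_cst; near=> z; rewrite /F.
    have : (Q * 'X + c%:P).[z - p] = (z - p) ^+ n.+1 * G z by near: z.
    rewrite hornerMXaddC hornerXn exprS => H.
    by rewrite mulrBr mulrA -H; ring.
  by rewrite -(cvg_lim _ Fc) // (cvg_lim _ F0).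
rewrite c0 addr0 in sP HP *; rewrite (IH Q) ?mul0r //.
  have [->|Q0] := eqVneq Q 0; first by rewrite size_poly0.
  by rewrite -ltnS -size_mulX.
near=> z.
have zp : z - p != 0 by rewrite subr_eq0; near: z; exact: nbhs_dnbhs_neq.
apply: (mulIf zp); rewrite -hornerMX mulrAC -exprSr.
by near: z.
Unshelve. all: by end_near.
Qed.

Definition laurent F p (c : seq K) := exists2 G : K -> K,
  (\forall z \near p, derivable G z 1) &
  \forall z \near p^', F z = \sum_(i < size c) c`_i / (z - p) ^+ i.+1 + G z.

(** Multiplying by $(z-p)^n$ turns the difference of the polar parts into a polynomial of degree
    below [n], equal to $(z-p)^n$ times a function differentiable at [p]. *)
Lemma laurent_unique F p c c' : laurent F p c -> laurent F p c' ->
  forall i, c`_i = c'`_i.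
Proof.
move=> [G dG HG] [G' dG' HG'] i.
pose n := maxn (size c) (size c').
have widen (e : seq K) : (size e <= n)%N -> forall z,
    \sum_(i < size e) e`_i / (z - p) ^+ i.+1 =
    \sum_(i < n) e`_i / (z - p) ^+ i.+1.
  move=> en z; rewrite (big_ord_widen n (fun i => e`_i / (z - p) ^+ i.+1)) //.
  rewrite big_mkcond; apply: eq_bigr => j _; case: ltnP => // je.
  by rewrite nth_default // mul0r.
(* The coefficients are reversed because $(z-p)^n/(z-p)^{i+1}=(z-p)^{n-i-1}$. *)
pose P := \poly_(k < n) (c`_(n - k.+1) - c'`_(n - k.+1)).
have P0 : P = 0.
  apply: (@horner_eq0_near P n (fun z => G' z - G z) p).
  - exact: size_poly.
  - apply: derivable_add; first exact: nbhs_singleton dG'.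
    by apply: derivable_opp; exact: nbhs_singleton dG.
  near=> z.
  have zp : z - p != 0 by rewrite subr_eq0; near: z; exact: nbhs_dnbhs_neq.
  have E : F z = \sum_(i < size c) c`_i / (z - p) ^+ i.+1 + G z by near: z.
  have E' : F z = \sum_(i < size c') c'`_i / (z - p) ^+ i.+1 + G' z by near: z.
  have -> : G' z - G z = \sum_(i < n) (c`_i - c'`_i) / (z - p) ^+ i.+1.
    under eq_bigr do rewrite mulrBl.
    rewrite sumrB -!widen ?leq_maxl ?leq_maxr //.
    move: E; rewrite E'; move: (\sum_(i < size c) _) (\sum_(i < size c') _) => S S'.
    by move=> /(canRL (addKr _)) ->; ring.
  rewrite horner_poly mulr_sumr (reindex_inj rev_ord_inj) /=.
  apply: eq_bigr => j _; rewrite subnSK // subKn ?(ltnW (ltn_ord j)) //.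
  have -> : (z - p) ^+ n = (z - p) ^+ j.+1 * (z - p) ^+ (n - j.+1).
    by rewrite -exprD subnKC.
  by field; rewrite expf_neq0.
have [ni|ni] := leqP n i.
  by rewrite !nth_default // (leq_trans _ ni) // ?leq_maxl ?leq_maxr.
have := congr1 (fun Q : {poly K} => Q`_(n - i.+1)) P0.
rewrite coef_poly coef0 ltn_subrL (leq_ltn_trans _ ni) //= subnSK //.
by rewrite subKn ?(ltnW ni) // => /eqP; rewrite subr_eq0 => /eqP.
Unshelve. all: by end_near.
Qed.

(** Allowing [r = 0] treats regular points and simple poles together, so sums need no case
    analysis. *)
Definition simple_part F p r := exists2 G : K -> K,
  (\forall z \near p, derivable G z 1) &
  \forall z \near p^', F z = r / (z - p) + G z.

Lemma simple_part_laurent F p r : simple_part F p r <-> laurent F p [:: r].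
Proof.
by split=> -[G dG HG]; exists G => //; apply: filterS HG => z ->;
  rewrite big_ord1 expr1.
Qed.

Lemma simple_part_holo F p : (\forall z \near p, derivable F z 1) ->
  simple_part F p 0.
Proof.
by move=> dF; exists F => //; near=> z; rewrite mul0r add0r.
Unshelve. all: by end_near.
Qed.

Lemma simple_partD F G p r s : simple_part F p r -> simple_part G p s ->
  simple_part (fun z => F z + G z) p (r + s).
Proof.
move=> [F' dF HF] [G' dG HG]; exists (fun z => F' z + G' z).
  by apply: filterS2 dF dG => z; exact: derivable_add.
near=> z.
have -> : F z = r / (z - p) + F' z by near: z.
have -> : G z = s / (z - p) + G' z by near: z.
by ring.
Unshelve. all: by end_near.
Qed.

Lemma simple_part_sum n (F : nat -> K -> K) p (r : nat -> K) :
  (forall i, (i < n)%N -> simple_part (F i) p (r i)) ->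
  simple_part (fun z => \sum_(i < n) F i z) p (\sum_(i < n) r i).
Proof.
elim: n => [_|n IH H].
  rewrite big_ord0 (_ : (fun z => _) = cst 0).
    by apply: simple_part_holo; near=> z; exact: derivable_cst.
  by apply/funext => z; rewrite big_ord0.
rewrite big_ord_recr (_ : (fun z => _) = (fun z => \sum_(i < n) F i z + F n z)).
  apply: simple_partD; last exact: H.
  by apply: IH => i ni; apply: H; rewrite ltnS ltnW.
by apply/funext => z; rewrite big_ord_recr.
Unshelve. all: by end_near.
Qed.

(** Split $L(z)r/(z-p)$ into $L(p)r/(z-p)$ and [r] times the slope of [L], which is regular by
    [removable_slope]. *)
Lemma simple_partM L F p r : expands L p ->
  (\forall z \near p, derivable L z 1) -> simple_part F p r ->
  simple_part (fun z => L z * F z) p (L p * r).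
Proof.
move=> eL dL [G dG HG]; have [a da] := removable_slope eL dL.
exists (fun z => slope L p a z * r + L z * G z).
  apply: filterS3 dL da dG => z dLz daz dGz; apply: derivable_add.
    by apply: (@derivable_mul _ _ (cst r)); [exact: daz|exact: derivable_cst].
  exact: derivable_mul.
near=> z.
have zp : z != p by near: z; exact: nbhs_dnbhs_neq.
have zp0 : z - p != 0 by rewrite subr_eq0.
have -> : F z = r / (z - p) + G z by near: z.
by rewrite /slope (negbTE zp); field.
Unshelve. all: by end_near.
Qed.

Lemma simple_part_cst c F p r : simple_part F p r ->
  simple_part (fun z => c * F z) p (c * r).
Proof.
have dc z : derivable (cst c) z 1 by exact: derivable_cst.
apply: (@simple_partM (cst c)); last by near=> z.
exists 0, 0, 0; split=> //; near=> h.
by rewrite !mul0r !addr0 subrr normr0.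
Unshelve. all: by end_near.
Qed.

Lemma near_dnbhs_sub p q (P : K -> Prop) :
  (\forall z \near (p - q)^', P z) -> \forall z \near p^', P (z - q).
Proof.
move=> H; have : \forall z \near (p - q), z != p - q -> P z by exact: H.
move=> /near_sub; apply: filterS => z zP zp; apply: zP.
by rewrite (inj_eq (addIr _)).
Qed.

Lemma simple_part_shift F p q r : simple_part F (p - q) r ->
  simple_part (fun z => F (z - q)) p r.
Proof.
move=> [G dG HG]; exists (fun z => G (z - q)).
  exact: derivable_near_shift.
by apply: filterS (near_dnbhs_sub HG) => z ->; rewrite opprB addrA subrK.
Qed.

End PrincipalParts.

(** * Splitting the Hilbert series into residue classes *)

Section CPow.
Variable R : realType.
Implicit Types (p z w : C R) (s t x y : R).

Lemma cpowV_expands t p : expands (fun z => (cpow t z)^-1) p.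
Proof.
have -> : (fun z => (cpow t z)^-1) = (fun z => logpow 0 z t).
  by apply/funext => z; rewrite logpow_cpow.
have [B [B0 HB]] := dlogpow_locally_bounded 0 3 t (complex.Re `|p| + 1).
exists (- logpow 1 p t), (logpow 2 p t / 2), (rc B).
split; first by rewrite -rc0 ler_rc.
near=> h; have h1 : `|h| <= 1 by near: h; exact: near0_le1.
have := @expansion_chain R (fun i z => (-1) ^+ i * logpow i z t) p h B.
rewrite expr0 expr1 !mul1r mulN1r sqrrN expr1n mul1r; apply=> //.
- move=> i z k s _.
  apply: cderiv_eq (cderivMl ((-1) ^+ i) (cderiv_dlogpow_z 0 i z k t s)) => //.
  by rewrite exprS /=; ring.
- move=> k k1; rewrite normrM normrX normrN normr1 expr1n mul1r.
  apply: HB; rewrite rcD rc1 (le_trans (ler_normD _ _)) // lerD //.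
Unshelve. all: by end_near.
Qed.

Lemma cpowV_derivable t p : derivable (fun z => (cpow t z)^-1) p 1.
Proof. exact/expands_derivable/cpowV_expands. Qed.

Lemma cpowM s t z : 0 < s -> 0 < t -> cpow (s * t) z = cpow s z * cpow t z.
Proof.
move=> s0 t0; have L : rc (ln (s * t)) = rc (ln s) + rc (ln t).
  by rewrite -rcD -lnM.
by rewrite /cpow -/(rc (ln (s * t))) L mulrDl cexpD.
Qed.

Lemma cpowD t z w : cpow t (z + w) = cpow t z * cpow t w.
Proof. by rewrite /cpow mulrDr cexpD. Qed.

Lemma cpow_nat t k : 0 < t -> cpow t k%:R = rc (t ^+ k).
Proof.
move=> t0; rewrite /cpow -rcn -/(rc (ln t)) -rcM cexp_rc.
by rewrite expRM_natr lnK.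
Qed.

Lemma hurwitz_zetaP x : 0 < x -> is_hurwitz_zeta x (hurwitz_zeta x).
Proof. by move=> x0; apply: xgetPex; exact: hurwitz_zeta_exists. Qed.

End CPow.

Section ResidueClasses.
Variables (K : numClosedFieldType) (D : nat).
Hypothesis D0 : (0 < D)%N.

(** For [j < D], the number of $n<N$ congruent to $j$ modulo $D$. *)
Definition class_size (N j : nat) := (N %/ D + (j < N %% D))%N.

Lemma class_sizeS N j : (j < D)%N ->
  class_size N.+1 j = (class_size N j + (j == N %% D :> nat))%N.
Proof.
move=> jD; rewrite /class_size {1 2}(divn_eq N D) -addnS.
have rD := ltn_pmod N D0; move: (N %% D)%N rD => r rD.
rewrite divnMDl // modnMDl; have [rE|rN] := eqVneq r.+1 D.
  have jr : (j <= r)%N by rewrite -ltnS rE.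
  rewrite rE divnn modnn D0 ltn0 !addn0 -addnA; congr addn.
  by move: jr; case: ltngtP.
have rl : (r.+1 < D)%N by rewrite ltn_neqAle rN.
rewrite (divn_small rl) (modn_small rl) addn0 -addnA; congr addn.
by rewrite ltnS leq_eqVlt; case: ltngtP.
Qed.

Lemma sum_classes (f : nat -> K) N :
  \sum_(0 <= n < N) f n =
  \sum_(j < D) \sum_(0 <= l < class_size N j) f (j + D * l)%N.
Proof.
elim: N => [|N IH].
  by rewrite big_nil big1 // => j _; rewrite /class_size div0n mod0n big_nil.
pose j0 := Ordinal (ltn_pmod N D0).
rewrite big_nat_recr //= IH (bigD1 j0) //= [RHS](bigD1 j0) //=.
have -> : \sum_(i < D | i != j0) \sum_(0 <= l < class_size N.+1 i) f (i + D * l)%N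
  = \sum_(i < D | i != j0) \sum_(0 <= l < class_size N i) f (i + D * l)%N.
  apply: eq_bigr => i ij; rewrite class_sizeS // (_ : (_ == _) = false) ?addn0 //.
  by apply: negbTE; apply: contraNneq ij => ij; apply/eqP/val_inj.
rewrite class_sizeS ?ltn_pmod // eqxx addn1 big_nat_recr //=.
rewrite addrAC; congr (_ + f _ + _).
by rewrite /class_size ltnn addn0 addnC mulnC -divn_eq.
Qed.

Lemma cvg_class_size j : (fun N => class_size N j) @ \oo --> \oo.
Proof.
apply/cvgnyPge => A; near=> N.
apply: leq_trans (leq_addr _ _); rewrite leq_divRL //.
by near: N; exact: nbhs_infty_ge.
Unshelve. all: by end_near.
Qed.

(** A unit shift only rotates the summands; this frees the residues from the starting index of the
    tail. *)
Lemma sum_periodic (f : nat -> K) b : (forall n, f (n + D)%N = f n) ->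
  \sum_(j < D) f (j + b)%N = \sum_(j < D) f j.
Proof.
move=> fD; elim: b => [|b <-]; first by apply: eq_bigr => j _; rewrite addn0.
case: D fD D0 => // E fD _.
rewrite big_ord_recr [RHS]big_ord_recl /= addrC; congr (_ + _).
  by rewrite add0n -[RHS]fD addnS addnC -addSnnS.
by apply: eq_bigr => j _; rewrite /bump /= add1n addnS.
Qed.

End ResidueClasses.

(** * Dirichlet series with periodic coefficients *)

Section ClassZeta.
Variables (R : realType) (D b : nat) (q : nat -> C R).
Hypotheses (D0 : (0 < D)%N) (b0 : (0 < b)%N).
Hypothesis qD : forall n, q (n + D)%N = q n.
Implicit Types (w z : C R) (j n N : nat).

Let base j : R := (j + b)%:R / D%:R.

Let base_gt0 j : 0 < base j.
Proof. by rewrite divr_gt0 ?ltr0n // addn_gt0 b0 orbT. Qed.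

(** The continuation of $\sum_{n\ge b}q(n)n^{-w}$. *)
Definition class_zeta w : C R := (cpow D%:R w)^-1 *
  \sum_(j < D) q (j + b)%N * hurwitz_zeta (base j) w.

Lemma class_zeta_derivable w : w != 1 -> derivable class_zeta w 1.
Proof.
move=> w1; apply: derivable_mul; first exact: cpowV_derivable.
apply: (@derivable_big _ _ (fun j w => q (j + b)%N * hurwitz_zeta (base j) w)).
move=> j _; apply: (@derivable_mul _ (cst _)); first exact: derivable_cst.
by have [/(_ _ w1)/nbhs_singleton] := hurwitz_zetaP (base_gt0 j).
Qed.

Lemma class_zeta_simple :
  simple_part class_zeta 1 (D%:R^-1 * \sum_(j < D) q j).
Proof.
(* The prefactor at 1 is $1/D$, each Hurwitz function has residue 1, and periodicity removes the
   shift by [b]. *)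
have -> : D%:R^-1 * \sum_(j < D) q j =
    (cpow D%:R 1)^-1 * \sum_(j < D) q (j + b)%N * 1.
  rewrite -[X in cpow _ X]/(1%:R) cpow_nat ?ltr0n // expr1 rcn; congr (_ * _).
  rewrite -(sum_periodic D0 b qD).
  by apply: eq_bigr => j _; rewrite mulr1.
apply: (@simple_partM _ (fun w => (cpow D%:R w)^-1)).
- exact: cpowV_expands.
- by near=> w; exact: cpowV_derivable.
- apply: (@simple_part_sum _ _ (fun j w => q (j + b)%N * hurwitz_zeta (base j) w)
    1 (fun j => q (j + b)%N * 1)) => j _.
  apply: simple_part_cst; apply/simple_part_laurent.
  by have [] := hurwitz_zetaP (base_gt0 j).
Unshelve. all: by end_near.
Qed.

Lemma class_zeta_series w : 1 < complex.Re w ->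
  (fun N => \sum_(0 <= n < N) q (n + b)%N * (cpow (n + b)%:R w)^-1) @ \oo -->
    class_zeta w.
Proof.
move=> w1.
pose S j M := series (fun n => (cpow (n%:R + base j) w)^-1) M.
have qDl j l : q (j + D * l)%N = q j.
  by elim: l => [|l IH]; rewrite ?muln0 ?addn0 // mulnS addnCA addnC qD.
have E N : \sum_(0 <= n < N) q (n + b)%N * (cpow (n + b)%:R w)^-1 =
    (cpow D%:R w)^-1 * \sum_(0 <= j < D) q (j + b)%N * S j (class_size D N j).
  rewrite (sum_classes D0) big_mkord mulr_sumr; apply: eq_bigr => j _.
  rewrite /S /series /= !mulr_sumr; apply: eq_bigr => l _.
  rewrite addnAC qDl.
  (* Each class is an arithmetic progression of step [D]; factoring [D] out leaves the terms of a
     Hurwitz series. *)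
  have -> : (j + b + D * l)%:R = D%:R * (l%:R + base j) :> R.
    rewrite /base !natrD natrM; field.
    by rewrite pnatr_eq0 -lt0n.
  rewrite cpowM ?ltr0n ?ltr_wpDl // invfM.
  by rewrite mulrCA.
rewrite (_ : (fun N => _) = (fun N => (cpow D%:R w)^-1 *
    \sum_(0 <= j < D) q (j + b)%N * S j (class_size D N j))); last first.
  by apply/funext.
rewrite /class_zeta; apply: cvgn_scale.
rewrite -(big_mkord xpredT (fun j => q (j + b)%N * hurwitz_zeta (base j) w)).
apply: cvgn_sum => j _; apply: cvgn_scale.
have [_ _ /(_ _ w1) H] := hurwitz_zetaP (base_gt0 j).
exact: (cvg_comp _ _ (cvg_class_size D0 j) H).
Qed.

End ClassZeta.

(** * The zeta function attached to an eventual quasi-polynomial *)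

Section HilbertZeta.
Variables (R : realType) (H : nat -> nat) (D m : nat) (d : nat -> nat -> C R).
Hypothesis D0 : (0 < D)%N.
Hypothesis hqp : hilbert_quasi_poly H D m d.
Implicit Types (z p : C R) (k n : nat).

Let b := tail_start H m d.

Let b0 : (0 < b)%N. Proof. exact: leq_maxl. Qed.

Let dD k : (k < m)%N -> forall n, d k (n + D)%N = d k n.
Proof. by case: hqp => H1 _ _ km n; exact: H1. Qed.

(** Some threshold exists by hypothesis, hence a least one, so [xget] does not fall back on its
    default. *)
Lemma agree_alpha : agree_from H m d (alpha H m d).
Proof.
have [_ _ [N HN]] := hqp.
have exN : exists n, `[< agree_from H m d n >] by exists N; exact/asboolP.
have [n /asboolP an nmin] := ex_minnP exN.
have [] // := xgetPex 0%N
  (P := [set N | agree_from H m d N /\ forall N', agree_from H m d N' -> (N <= N')%N]).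
exists n; split=> // n' an'; apply: nmin; exact/asboolP.
Qed.

Definition hilbert_zeta z : C R :=
  theta H m d z + \sum_(k < m) class_zeta D b (d k) (z - k%:R).

Lemma theta_derivable z : derivable (theta H m d) z 1.
Proof.
rewrite (_ : theta H m d = fun z => \sum_(i < alpha H m d - 1)
    (H (i + 1)%N)%:R * (cpow (i + 1)%:R z)^-1).
  apply: (@derivable_big _ _ (fun i z => (H (i + 1)%N)%:R * (cpow (i + 1)%:R z)^-1)).
  move=> i _; apply: (@derivable_mul _ (cst _)); first exact: derivable_cst.
  exact: cpowV_derivable.
apply/funext => y; rewrite /theta -[X in \sum_(X <= _ < _) _]add0n.
by rewrite big_addn big_mkord.
Qed.

Lemma hilbert_zeta_derivable z : (forall k : 'I_m, z != k.+1%:R) ->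
  derivable hilbert_zeta z 1.
Proof.
move=> zm; apply: derivable_add; first exact: theta_derivable.
apply: (@derivable_big _ _ (fun k z => class_zeta D b (d k) (z - k%:R))) => k km.
apply: derivable_shift; apply: class_zeta_derivable => //.
by apply: contraNneq (zm (Ordinal km)) => /eqP; rewrite subr_eq nat1r.
Qed.

Definition hilbert_residue k : C R := D%:R^-1 * \sum_(j < D) d k j.

(** At most one term is nonzero: the k-th summand of [hilbert_zeta] is shifted by [k], so it can
    have a pole only at [k + 1]. *)
Definition principal_coef p : C R :=
  \sum_(k < m) if p == k.+1%:R then hilbert_residue k else 0.

Lemma principal_coefE (k : 'I_m) : principal_coef k.+1%:R = hilbert_residue k.
Proof.
rewrite /principal_coef (bigD1 k) //= eqxx big1 ?addr0 // => i ik.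
by rewrite eqr_nat eqSS eq_sym val_eqE (negbTE ik).
Qed.

Lemma hilbert_zeta_simple p : simple_part hilbert_zeta p (principal_coef p).
Proof.
rewrite -[principal_coef p]add0r; apply: simple_partD.
  by apply: simple_part_holo; near=> z; exact: theta_derivable.
apply: (@simple_part_sum _ _ (fun k z => class_zeta D b (d k) (z - k%:R)) p
  (fun k => if p == k.+1%:R then hilbert_residue k else 0)) => k km.
apply: simple_part_shift; case: eqP => [->|/eqP pk].
  rewrite -natr1 addrAC subrr add0r; apply: class_zeta_simple => //.
  exact: dD.
have pk1 : p - k%:R != 1 by rewrite subr_eq nat1r.
apply: simple_part_holo; near=> z; apply: class_zeta_derivable => //.
by near: z; exact: near_neq.
Unshelve. all: by end_near.
Qed.

Lemma tail_term n z : (b <= n)%N -> (H n)%:R / cpow n%:R z =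
  \sum_(k < m) d k n * (cpow n%:R (z - k%:R))^-1.
Proof.
move=> bn; have n0 : (0 < n)%N := leq_trans b0 bn.
have an : (alpha H m d <= n)%N := leq_trans (leq_maxr _ _) bn.
rewrite (agree_alpha an) /quasi_poly mulr_suml; apply: eq_bigr => k _.
rewrite -mulrA; congr (_ * _).
have -> : cpow n%:R z = cpow n%:R (z - k%:R) * n%:R ^+ k.
  by rewrite -{1}(subrK k%:R z) (cpowD _ (z - k%:R)) cpow_nat ?ltr0n // rcX rcn.
have nk : (n%:R ^+ k : C R) != 0 by rewrite expf_neq0 // pnatr_eq0 -lt0n.
by rewrite invfM mulrCA mulfV // mulr1.
Qed.

Lemma hilbert_series z : m%:R < complex.Re z ->
  series (fun n => (H n.+1)%:R / cpow n.+1%:R z) @ \oo --> hilbert_zeta z.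
Proof.
move=> zm.
pose T k N := \sum_(0 <= n < N) d k (n + b)%N * (cpow (n + b)%:R (z - k%:R))^-1.
(* The series starts at [H 1], so its first [N + b - 1] terms are those with $n<N+b$: the head below
   [b], then [N] terms of the tail. *)
have E N : series (fun n => (H n.+1)%:R / cpow n.+1%:R z) (N + b.-1)%N =
    theta H m d z + \sum_(0 <= k < m) T k N.
  rewrite /series /=.
  rewrite -(big_add1 _ _ 0%N (N + b.-1).+1 xpredT (fun n => (H n)%:R / cpow n%:R z)).
  rewrite -addnS prednK // (@big_cat_nat _ _ _ b) ?leq_addl //=; congr (_ + _).
    (* If [alpha] is 0 then [b = 1], and both the head and [theta] are empty sums. *)
    rewrite /theta /b /tail_start; have [->|a0] := posnP (alpha H m d).
      by rewrite !big_geq.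
    by rewrite (maxn_idPr a0).
  rewrite /T exchange_big /= -[X in \sum_(X <= _ < _) _]add0n big_addn addnK.
  by apply: eq_bigr => n _; rewrite tail_term ?leq_addl // big_mkord.
rewrite -(cvg_shiftn b.-1) (_ : [sequence _]_ _ =
  (fun N => theta H m d z + \sum_(0 <= k < m) T k N)); last exact/funext.
apply: cvgn_add; first exact: cvg_cst.
rewrite -(big_mkord xpredT (fun k => class_zeta D b (d k) (z - k%:R))).
apply: cvgn_sum => k km; apply: class_zeta_series => //; first exact: dD.
by rewrite ReD ReN Re_nat ltrBrDr (le_lt_trans _ zm) // nat1r ler_nat.
Qed.

Lemma near_not_special p :
  \forall z \near p^', forall k : 'I_m, z != k.+1%:R.
Proof.
apply: filter_forall => k; have [->|pk] := eqVneq p k.+1%:R.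
  exact: nbhs_dnbhs_neq.
by apply: cvg_within; exact: near_neq.
Qed.

(** At $1,\dots,m$ the formula [hilbert_zeta] evaluates a Hurwitz function at 1, where its value is
    arbitrary. Overwriting these values by regular parts makes the function holomorphic wherever the
    principal coefficient vanishes. *)
Lemma hilbert_zeta_continuation :
  exists2 zeta_M : C R -> C R,
    zeta_continuation H m%:R zeta_M &
    [/\ forall z : C R, (forall k : 'I_m, z != k.+1%:R) ->
          zeta_M z = hilbert_zeta z,
        forall p : C R, pole zeta_M p ->
          (exists k : 'I_m, p = k.+1%:R) /\ simple_pole zeta_M p
      & forall k : 'I_m, residue zeta_M k.+1%:R (hilbert_residue k)].
Proof.
have /choice[G HG] : forall p, exists g : C R -> C R,
    (\forall z \near p, derivable g z 1) /\
    \forall z \near p^', hilbert_zeta z = principal_coef p / (z - p) + g z.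
  by move=> p; have [g dg Hg] := hilbert_zeta_simple p; exists g.
pose special z := [exists k : 'I_m, z == k.+1%:R].
have specialPn z : ~~ special z -> forall k : 'I_m, z != k.+1%:R.
  by rewrite negb_exists => /forallP.
(* [G z z] is the value at [z] of the regular part chosen around [z] itself. *)
pose zM z := if special z then G z z else hilbert_zeta z.
have zME z : (forall k : 'I_m, z != k.+1%:R) -> zM z = hilbert_zeta z.
  by move=> zk; rewrite /zM ifN // negb_exists; exact/forallP.
have zMp p : \forall z \near p^', zM z = principal_coef p / (z - p) + G p z.
  near=> z; rewrite zME; last by near: z; exact: near_not_special.
  by near: z; exact: (HG p).2.
have pp p : principal_part zM p [:: principal_coef p].
  by apply: (simple_part_laurent _ _ _).1; exists (G p) => //; exact: (HG p).1.
have holo p : principal_coef p = 0 \/ ~~ special p -> holomorphic_at zM p.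
  (* At a special point with zero coefficient, [zM] agrees with [G p] on a full neighbourhood, [p]
     included. *)
  have [sp [c0|//]|nsp _] := boolP (special p).
    have E : \forall z \near p, G p z = zM z.
      have : \forall z \near p, z != p -> zM z = principal_coef p / (z - p) + G p z.
        exact: zMp.
      apply: filterS => z; have [-> _|_ -> //] := eqVneq z p.
        by rewrite /zM sp.
      by rewrite c0 mul0r add0r.
    apply: filterS2 (near_join E) (HG p).1 => z Ez; exact: near_eq_derivable.
  have Hns : \forall z \near p, forall k : 'I_m, z != k.+1%:R.
    have : \forall z \near p, z != p -> forall k : 'I_m, z != k.+1%:R.
      exact: near_not_special.
    apply: filterS => z; have [-> _|_ H1] := eqVneq z p; first exact: specialPn.
    exact: H1.
  have E : \forall z \near p, hilbert_zeta z = zM z.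
    by apply: filterS Hns => z /zME.
  apply: filterS2 (near_join E) Hns => z Ez Hz.
  exact: (near_eq_derivable Ez (hilbert_zeta_derivable Hz)).
(* A holomorphic point admits the principal part [[:: 0]], so by uniqueness every coefficient of
   another one vanishes. *)
have npole p : holomorphic_at zM p -> ~ pole zM p.
  move=> hp [c [g dg Hg]].
  have L0 : laurent zM p [:: 0].
    have hp' : \forall z \near p, derivable zM z 1 := hp.
    exact: (simple_part_laurent zM p 0).1 (simple_part_holo hp').
  have Lc : laurent zM p c by exists g.
  have c0 i : c`_i = 0.
    by rewrite (laurent_unique Lc L0) nth_seq1 if_same.
  by move/(has_nthP 0) => [i _]; rewrite c0 eqxx.
exists zM; last split=> //.
- split.
  + move=> p; have [c0|c0] := eqVneq (principal_coef p) 0.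
      by left; apply: holo; left.
    by right; exists [:: principal_coef p] => //=; rewrite c0.
  + move=> z zm; rewrite zME; first exact: hilbert_series.
    (* No special point lies in the half-plane, since [k + 1 <= m]. *)
    move=> k; apply: contraTneq zm => ->.
    by rewrite Re_nat ltr_nat -leqNgt.
- move=> p polep.
  have sp : special p by apply: contrapT => /negP nsp; apply: npole polep; apply: holo; right.
  split; first by have /existsP[k /eqP pk] := sp; exists k.
  exists (principal_coef p) => //; apply/eqP => c0.
  by apply: npole polep; apply: holo; left.
- move=> k; exists [:: principal_coef k.+1%:R] => //=.
  by rewrite principal_coefE.
Unshelve. all: by end_near.
Qed.

End HilbertZeta.

Theorem proposition1p6 (R : realType) (K : fieldType) (S : comAlgType K)
    (SG : nat -> {pred S}) (r : nat) (u : 'I_r -> S) (a : 'I_r -> nat)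
    (M : lmodType S) (MG : nat -> {pred M}) (m : nat)
    (d : nat -> nat -> C R) :
  let D := (\big[lcmn/1]_(i < r) a i)%N in
  let H := hilbert MG in
  let b := tail_start H m d in
  positively_graded SG ->
  generated_by u ->
  (forall i, (1 <= a i)%N /\ u i \in SG (a i)) ->
  graded_module SG MG ->
  finitely_generated M ->
  krull_dim M m ->
  hilbert_quasi_poly H D m d ->
  exists2 zeta_M : C R -> C R,
    zeta_continuation H m%:R zeta_M &
    [/\ forall z : C R, (forall k : 'I_m, z != k.+1%:R) ->
          zeta_M z = theta H m d z +
            \sum_(k < m) (cpow D%:R (z - k%:R))^-1 *
              \sum_(j < D) d k (j + b)%N *
                hurwitz_zeta ((j + b)%:R / D%:R) (z - k%:R),
        forall p : C R, pole zeta_M p ->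
          (exists k : 'I_m, p = k.+1%:R) /\ simple_pole zeta_M p
      & forall k : 'I_m,
          residue zeta_M k.+1%:R (D%:R^-1 * \sum_(j < D) d k j)].
Proof.
move=> D H b _ _ ua _ _ _ hqp.
have D0 : (0 < D)%N.
  apply: (big_ind (fun n => 0 < n)%N) => // [n k n0 k0|i _].
    by rewrite lcmn_gt0 n0.
  exact: (ua i).1.
exact: hilbert_zeta_continuation hqp.
Qed.
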